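(* Fix $I\in\mathbb{N}$. For each $N\in\mathbb{N}$, consider the box-ball system initiated from a random configuration $\eta$ with distribution $\mathbf{P}_N$ supported on $\Omega_I$. Suppose there exists $\psi^0=(\psi^0_i)_{i=1}^I\in\mathcal{D}$ such that, for every $\varepsilon>0$ and $u_0\in(0,\infty)$, \[\lim_{N\rightarrow\infty}\mathbf{P}_N\left(\sup_{i\in\{1,\dots,I\}}\sup_{u\leq u_0}\left|\psi_i^N(u,0)-\psi_i^0(u)\right|>\varepsilon\right)=0.\] Then for every $\varepsilon>0$, $t\in(0,\infty)$ and $u_0\in(0,\infty)$, \[\lim_{N\rightarrow\infty}\mathbf{P}_N\left(\sup_{i\in\{1,\dots,I\}}\sup_{u\leq u_0}\left|\psi_i^N(u,t)-\psi_i(u,t)\right|>\varepsilon\right)=0,\] where $\psi_i(u,t):=\left(\Upsilon^{-1}\circ\theta_t\circ\Upsilon\circ\psi^0\right)_i(u)$.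
   Context: Box-ball system: configurations $\eta\in\{0,1\}^{\mathbb{N}}$; carrier $W(0)=0$, $W(x)=W(x-1)+1$ if $\eta(x)=1$, $W(x)=W(x-1)$ if $\eta(x)=0,W(x-1)=0$, $W(x)=W(x-1)-1$ if $\eta(x)=0,W(x-1)>0$; dynamics $T\eta(x)=\min\{1-\eta(x),W(x-1)\}$. $\Omega=\{\eta:\limsup_{x\to\infty}\sum_{x'=1}^x(1-2\eta(x'))=\infty\}$ (and $T(\Omega)\subseteq\Omega$). Soliton decomposition of $\eta\in\Omega$: with $S(0)=0$, $S(x)-S(x-1)=1-2\eta(x)$, $M(x)=\max_{x'\le x}S(x')$, a record is $x=0$ or $x$ with $M(x)>M(x-1)$. Between consecutive records $x_0<x_1$, repeatedly (on the remaining sequence of sites $x_0+1,\dots,x_1-1$) take the left-most maximal run of equal values, of length $i$ say, that is followed by a run of length $\ge i$; this run and the first $i$ sites of the next run form a size-$i$ soliton; remove them and repeat until empty. $\sigma_i(x,k)=1$ if $T^k\eta$ has a size-$i$ soliton with left-most site $x$, else $0$. $\Omega_I=\{\eta\in\Omega:\sigma_i(x,0)=0\ \forall i>I,x\}$. $\psi_i^N(u,t)=\frac1N\sum_{x=1}^{\lfloor Nu\rfloor}\sigma_i(x,\lfloor Nt\rfloor)$. Continuous objects: $\mathcal{C}=\{f\in C(\mathbb{R}_+,\mathbb{R}_+):f(0)=0,f\text{ non-decreasing}\}$, $\mathcal{C}^\uparrow=\{f\in\mathcal{C}:f\text{ strictly increasing},\lim_{u\to\infty}f(u)=\infty\}$.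 For $\psi\in\mathcal{C}^I$, $\phi_i(u)=u-\sum_{j=1}^I2(i\wedge j)\psi_j(u)$. $\mathcal{D}=\{\psi\in\mathcal{C}^I:\phi_I\in\mathcal{C}^\uparrow,\ \sum_{i=1}^Ii\sup_{u_1\ne u_2}\frac{\psi_i(u_1)-\psi_i(u_2)}{\phi_i(u_1)-\phi_i(u_2)}<\frac12\}$ (for such $\psi$ every $\phi_i$ lies in $\mathcal{C}^\uparrow$). $\Upsilon(\psi)_i=\psi_i\circ\phi_i^{-1}$. $\bar{\mathcal{D}}=\{\bar\psi\in\mathcal{C}^I:\sum_i i\sup_{z_1\neq z_2}\frac{\bar\psi_i(z_1)-\bar\psi_i(z_2)}{z_1-z_2}<\frac12\}$. $(\theta_t\bar\psi)_i(z)=\bar\psi_i((z-it)\vee0)$. $\Upsilon$ is a bijection from $\mathcal{D}$ onto $\bar{\mathcal{D}}$, $\theta_t(\bar{\mathcal{D}})\subseteq\bar{\mathcal{D}}$, and $\Upsilon^{-1}$ denotes the inverse of $\Upsilon:\mathcal{D}\to\bar{\mathcal{D}}$. *)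

(* Defs.v *)
From HB Require Import structures.
From mathcomp Require Import all_boot all_order all_algebra.
From mathcomp Require Import all_classical all_reals all_analysis.
Set Implicit Arguments. Unset Strict Implicit. Unset Printing Implicit Defensive.
Import Order.TTheory GRing.Theory Num.Theory.
Import numFieldNormedType.Exports.
Local Open Scope classical_set_scope.
Local Open Scope ring_scope.

(* A configuration eta : {0,1}^N is a map nat -> bool; sites are 1,2,3,...;
   the value eta 0 is irrelevant (never used). *)
Definition config := nat -> bool.

Fixpoint carrier (eta : config) (x : nat) : nat :=
  match x with
  | 0 => 0
  | x'.+1 => if eta x'.+1 then (carrier eta x').+1
             else if carrier eta x' == 0 then 0 else (carrier eta x').-1
  end.

Definition bbs_step (eta : config) : config := fun x =>
  if x is 0 then false else minn (1 - eta x) (carrier eta x.-1) == 1.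

Definition Spath (eta : config) (x : nat) : int :=
  \sum_(1 <= x' < x.+1) (1 - 2 * (nat_of_bool (eta x'))%:Z).

Fixpoint Mpath (eta : config) (x : nat) : int :=
  match x with
  | 0 => Spath eta 0
  | x'.+1 => Num.max (Mpath eta x') (Spath eta x'.+1)
  end.

Definition is_record (eta : config) (x : nat) : bool :=
  (x == 0%N) || (Mpath eta x.-1 < Mpath eta x).

Definition Omega (eta : config) : Prop :=
  forall (K : int) (x0 : nat), exists2 x, (x0 <= x)%N & K <= Spath eta x.

Definition sv := (nat * bool)%type.

Fixpoint runs (s : seq sv) : seq (seq sv) :=
  match s with
  | [::] => [::]
  | a :: s' =>
      match runs s' with
      | (b :: r) :: rs =>
          if a.2 == b.2 then (a :: b :: r) :: rs else [:: a] :: (b :: r) :: rs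
      | _ => [:: [:: a]]
      end
  end.

(* one step: take the left-most run, of length i say, followed by a run of
   length >= i; this run and the first i entries of the next run form a
   size-i soliton, whose left-most site is the first site of the run.
   Returns (size, left-most site) and the remaining sequence. *)
Definition soliton_step (s : seq sv) : option ((nat * nat) * seq sv) :=
  let rs := runs s in
  let pairs := zip rs (behead rs) in
  let k := find (fun p : seq sv * seq sv => size p.1 <= size p.2)%N pairs in
  if (k < size pairs)%N then
    let r1 := nth [::] rs k in
    let r2 := nth [::] rs k.+1 in
    let i := size r1 in
    Some ((i, (head (0%N, false) r1).1),
          flatten (take k rs) ++ drop i r2 ++ flatten (drop k.+2 rs))
  else None.

Fixpoint soliton_decomp_fuel (fuel : nat) (s : seq sv) : seq (nat * nat) :=
  match fuel with
  | 0 => [::]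
  | f.+1 => match soliton_step s with
            | Some (p, s') => p :: soliton_decomp_fuel f s'
            | None => [::]
            end
  end.

(* list of (size, left-most site) of the solitons of the sequence s;
   each step removes at least two entries, so size s steps suffice *)
Definition soliton_decomp (s : seq sv) : seq (nat * nat) :=
  soliton_decomp_fuel (size s) s.

Definition segment (eta : config) (x0 x1 : nat) : seq sv :=
  [seq (x, eta x) | x <- iota x0.+1 (x1 - x0.+1)].

Definition consecutive_records (eta : config) (x0 x1 : nat) : Prop :=
  [/\ is_record eta x0, is_record eta x1, (x0 < x1)%N &
      forall y, (x0 < y < x1)%N -> ~~ is_record eta y].

Definition has_soliton (eta : config) (i x : nat) : Prop :=
  exists x0 x1, consecutive_records eta x0 x1 /\
                (i, x) \in soliton_decomp (segment eta x0 x1).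

Definition sigma (eta : config) (i x k : nat) : nat :=
  if `[< has_soliton (iter k bbs_step eta) i x >] then 1 else 0.

Definition OmegaI (I : nat) (eta : config) : Prop :=
  Omega eta /\ forall i x, (I < i)%N -> sigma eta i x 0 = 0%N.

Definition psiN (R : realType) (N : nat) (eta : config) (i : nat) (u t : R) : R :=
  N%:R^-1 * \sum_(1 <= x < (Num.truncn (N%:R * u)).+1)
              (sigma eta i x (Num.truncn (N%:R * t)))%:R.

(* Functions R_+ -> R_+ are represented as functions R -> R, only their
   values on [0, +oo) matter.  Families psi = (psi_i)_{i=1..I} are
   represented as nat -> R -> R, only the indices 1..I matter. *)
Section Continuum.
Variable R : realType.

Definition inC (f : R -> R) : Prop :=
  [/\ f 0 = 0,
      forall u, 0 <= u -> 0 <= f u,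
      {within `[0, +oo[, continuous f} &
      forall u v, 0 <= u -> u <= v -> f u <= f v].

Definition inCup (f : R -> R) : Prop :=
  [/\ inC f,
      forall u v, 0 <= u -> u < v -> f u < f v &
      f x @[x --> +oo] --> +oo].

Definition inCI (I : nat) (psi : nat -> R -> R) : Prop :=
  forall i, (1 <= i <= I)%N -> inC (psi i).

Definition phi (I : nat) (psi : nat -> R -> R) (i : nat) (u : R) : R :=
  u - \sum_(1 <= j < I.+1) (2 * minn i j)%:R * psi j u.

Definition ratio_sup (I : nat) (psi : nat -> R -> R) (i : nat) : \bar R :=
  ereal_sup [set y : \bar R | exists u1 u2,
     [/\ 0 <= u1, 0 <= u2, u1 != u2 &
         y = ((psi i u1 - psi i u2) / (phi I psi i u1 - phi I psi i u2))%:E]].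

Definition inD (I : nat) (psi : nat -> R -> R) : Prop :=
  [/\ inCI I psi, inCup (phi I psi I) &
      (\sum_(1 <= i < I.+1) (i%:R)%:E * ratio_sup I psi i < (2^-1)%:E)%E].

(* inverse of a map R_+ -> R_+ (meaningful when it is a bijection) *)
Definition inv_pos (f : R -> R) (z : R) : R :=
  match pselect (exists u, 0 <= u /\ f u = z) with
  | left h => projT1 (cid h)
  | right _ => 0
  end.

Definition Upsilon (I : nat) (psi : nat -> R -> R) : nat -> R -> R :=
  fun i z => psi i (inv_pos (phi I psi i) z).

Definition theta (t : R) (bpsi : nat -> R -> R) : nat -> R -> R :=
  fun i z => bpsi i (Num.max (z - i%:R * t) 0).

(* Upsilon^{-1} : the psi in D with Upsilon(psi) = bpsi (on indices 1..I,
   arguments z >= 0); unique since Upsilon is a bijection D -> Dbar *)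
Definition Upsilon_inv (I : nat) (bpsi : nat -> R -> R) : nat -> R -> R :=
  match pselect (exists psi, inD I psi /\
         forall i z, (1 <= i <= I)%N -> 0 <= z -> Upsilon I psi i z = bpsi i z) with
  | left h => projT1 (cid h)
  | right _ => fun _ _ => 0
  end.

Definition sup_dev (I : nat) (f g : nat -> R -> R) (u0 : R) : \bar R :=
  ereal_sup [set y : \bar R | exists i u,
     [/\ (1 <= i <= I)%N, 0 <= u <= u0 & y = (`|f i u - g i u|)%:E]].

End Continuum.

(* Main.v *)
Require Import Defs.
From HB Require Import structures.
From mathcomp Require Import all_boot all_order all_algebra.
From mathcomp Require Import all_classical all_reals all_analysis.
From mathcomp Require Import zify ring lra.
Set Implicit Arguments. Unset Strict Implicit. Unset Printing Implicit Defensive.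
Import Order.TTheory GRing.Theory Num.Theory.
Import numFieldNormedType.Exports.

(** Give the carrier numbered seats: a ball takes the lowest empty seat, and an
    empty site unloads the lowest occupied one.  Sites that use none of the
    seats 1, ..., k are the "k-slots".  One step of the dynamics loads seat k
    exactly where seat k is unloaded in the previous configuration; hence at a
    k-slot the number of fillings of seat k minus that of seat k+1, which counts
    the size-k solitons passed so far, is carried by one step from slot number
    y to slot number y + k, without any error.  Iterating gives an exact linear
    evolution over arbitrarily long times.

    The soliton decomposition, read from left to right, is a stack of runs of
    strictly decreasing lengths.  On [Omega_I] the stack has at most I runs, so
    soliton counts and slot counts at a site differ from the seat counts by
    constants depending on I only, and these disappear after division by N.

    In the limit one gets psi_i = chi_i o phi_i with chi_i = theta_t (Upsilon psi0)_i,
    where chi_i is L_i-Lipschitz and sum_i i L_i < 1/2.  This system is a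
    contraction for the weighted norm sum_i i |psi_i|, so its approximate
    solutions are close to [Upsilon_inv]. *)

Local Open Scope nat_scope.

(** * Seats of the carrier and slots *)

(* The content of a carrier of capacity [k], i.e. the number of occupied seats
   among the [k] lowest ones; seat [k.+1] is occupied when [cap k.+1] exceeds
   [cap k]. *)
Fixpoint cap (k : nat) (eta : config) (x : nat) : nat :=
  if x is x'.+1 then
    if eta x'.+1 then minn (cap k eta x').+1 k else (cap k eta x').-1
  else 0.

Fixpoint loads (k : nat) (eta : config) (x : nat) : nat :=
  if x is x'.+1 then loads k eta x' + (eta x'.+1 && (cap k eta x' < k)) else 0.

Fixpoint unloads (k : nat) (eta : config) (x : nat) : nat :=
  if x is x'.+1 then unloads k eta x' + (~~ eta x'.+1 && (0 < cap k eta x'))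
  else 0.

Fixpoint slots (k : nat) (eta : config) (x : nat) : nat :=
  if x is x'.+1 then
    slots k eta x' + (if eta x'.+1 then cap k eta x' == k else cap k eta x' == 0)
  else 0.

(** Site 0 is a slot by convention, namely slot number 0. With this choice [slots k eta] numbers the
    slot sites injectively, starting from 0. *)
Definition slot_site (k : nat) (eta : config) (x : nat) : bool :=
  if x is x'.+1 then slots k eta x == (slots k eta x').+1 else true.

Lemma bbs_stepS eta x :
  bbs_step eta x.+1 = ~~ eta x.+1 && (0 < carrier eta x).
Proof. by rewrite /bbs_step /=; case: (eta _); case: (carrier _ _) => [|[|n]]. Qed.

Arguments bbs_step : simpl never.

Lemma cap_le k eta x : cap k eta x <= k.
Proof. by elim: x => //= x IH; case: (eta _); lia. Qed.

Lemma cap_leS k eta x :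
  cap k eta x <= cap k.+1 eta x <= (cap k eta x).+1.
Proof.
elim: x => //= x /andP[H1 H2]; have := cap_le k eta x; have := cap_le k.+1 eta x.
by case: (eta _); lia.
Qed.

Lemma cap_le_carrier k eta x : cap k eta x <= carrier eta x.
Proof. by elim: x => //= x; case: (eta _); case: (carrier eta x) => [|c] /=; lia. Qed.

Lemma loadsE k eta x : loads k eta x = unloads k eta x + cap k eta x.
Proof.
elim: x => //= x ->; have := cap_le k eta x.
by case: (eta _) => /=; lia.
Qed.

Lemma slotsE k eta x : slots k eta x + loads k eta x + unloads k eta x = x.
Proof.
elim: x => //= x IH; have := cap_le k eta x; case: (eta _) => /=; lia.
Qed.

(** While the carrier is non-empty, the two configurations take opposite values, so the two contents
    move in opposite directions. Equality sets in when the carrier of [eta] first exceeds capacity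
    [k], where the contents are [k] and 0, and it lasts as long as some higher seat is occupied. *)
Lemma cap_bbs_step k eta x :
  (cap k eta x + cap k (bbs_step eta) x <= k) &&
  ((cap k eta x < carrier eta x) ==>
     (cap k eta x + cap k (bbs_step eta) x == k)).
Proof.
elim: x => [|x]; first by [].
have := cap_le_carrier k eta x; have := cap_le k eta x.
have := cap_le k (bbs_step eta) x.
rewrite /= bbs_stepS; case: (eta _) => /=; first lia.
by case: (carrier eta x) => [|c] /=; lia.
Qed.

Lemma cap_bbs_step_le k eta x : cap k eta x + cap k (bbs_step eta) x <= k.
Proof. by have /andP[] := cap_bbs_step k eta x. Qed.

Lemma cap_bbs_step_eq k eta x : cap k eta x < carrier eta x ->
  cap k eta x + cap k (bbs_step eta) x = k.
Proof. by move=> H; have /andP[_ /implyP/(_ H)/eqP] := cap_bbs_step k eta x. Qed.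

(* The mechanism behind the linearization. *)
Lemma loads_bbs_step k eta x : loads k (bbs_step eta) x = unloads k eta x.
Proof.
elim: x => //= x ->; rewrite bbs_stepS; congr (_ + _).
have := cap_bbs_step_le k eta x; have := @cap_bbs_step_eq k eta x.
have := cap_le_carrier k eta x.
by case: (eta _) => //=; case: (ltnP 0 (carrier eta x)) => /=; lia.
Qed.

(** In particular a step never lowers [slots k]; this is what later keeps slots and records
    unbounded in time. *)
Lemma slots_bbs_step k eta x : slots k (bbs_step eta) x =
  slots k eta x + cap k eta x + cap k (bbs_step eta) x.
Proof.
have := slotsE k eta x; have := slotsE k (bbs_step eta) x.
rewrite loads_bbs_step; have := loadsE k (bbs_step eta) x; rewrite loads_bbs_step.
have := loadsE k eta x; lia.
Qed.

Lemma slotsS k eta x :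
  slots k eta x.+1 = slots k eta x + (if eta x.+1 then cap k eta x == k else cap k eta x == 0).
Proof. by []. Qed.

Lemma slots_leS k eta x : slots k eta x <= slots k eta x.+1.
Proof. by rewrite /= leq_addr. Qed.

Lemma slots_homo k eta : {homo slots k eta : x y / x <= y}.
Proof. by apply: homo_leq; [exact: leqnn | exact: leq_trans | exact: slots_leS]. Qed.

Lemma slot_site_lt k eta x z : slot_site k eta x -> z < x ->
  slots k eta z < slots k eta x.
Proof.
case: x => // x /eqP Hx; rewrite ltnS => /(slots_homo k eta).
by rewrite Hx ltnS.
Qed.

Lemma exists_slot_site k eta y : (exists x, y <= slots k eta x) ->
  exists2 x, slot_site k eta x & slots k eta x = y.
Proof.
move=> H; case: (ex_minnP H) => -[|x] Hx Hmin.
  by exists 0 => //; move: Hx => /=; lia.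
have Hx' : slots k eta x < y.
  by rewrite ltnNge; apply/negP => /Hmin; rewrite ltnn.
have := Hx; have : slots k eta x.+1 <= (slots k eta x).+1.
  by rewrite /=; case: ifP => _; lia.
move=> H1 H2; exists x.+1; first by apply/eqP; lia.
lia.
Qed.

(** * Unloadings of one seat, and their position among the slots of two successive configurations *)

(** The event that seat [k.+1] is unloaded at site [x.+1]: it is the lowest occupied one. The
    difference of [unloads k.+1] and [unloads k] counts these events; the index is the site before
    the event. *)
Definition drop_seat (k : nat) (eta : config) (x : nat) : bool :=
  [&& ~~ eta x.+1, cap k eta x == 0 & 0 < cap k.+1 eta x].

Lemma unloads_const k eta x y : x <= y ->
  (forall z, x <= z < y -> ~~ drop_seat k eta z) ->
  unloads k.+1 eta y + unloads k eta x = unloads k.+1 eta x + unloads k eta y.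
Proof.
move=> /subnKC <-; elim: (y - x) => [|n IH] H; first by rewrite addn0 addnC.
have {}IH := IH (fun z Hz => H z ltac:(lia)).
have := H (x + n) ltac:(lia); rewrite /drop_seat addnS /=.
by have := cap_leS k eta (x + n); case: (eta _) => /=; lia.
Qed.

Lemma unloads_diff_eq k eta x x' :
  (forall z, drop_seat k eta z -> (z < x') = (z < x)) ->
  unloads k.+1 eta x' + unloads k eta x = unloads k.+1 eta x + unloads k eta x'.
Proof.
move=> H; case: (leqP x x') => Hx; first apply: unloads_const => // z Hz.
  by apply/negP => /H; lia.
apply/esym; rewrite addnC [RHS]addnC addnC [RHS]addnC.
have: forall z, x' <= z < x -> ~~ drop_seat k eta z.
  by move=> z Hz; apply/negP => /H; lia.
by move/(unloads_const (ltnW Hx)) => ->.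
Qed.

(** When seat [k.+1] is unloaded, the seats below it are empty in [eta] and, by complementarity,
    full in [bbs_step eta]. The two contents at capacity [k.+1] thus add up to [1 + k], the exact
    shift of the slot number. *)
Lemma drop_seat_slots k eta z : drop_seat k eta z ->
  [/\ slots k.+1 eta z.+1 = slots k.+1 eta z,
      slots k.+1 (bbs_step eta) z.+1 = slots k.+1 (bbs_step eta) z &
      slots k.+1 (bbs_step eta) z.+1 = slots k.+1 eta z.+1 + k.+1].
Proof.
case/and3P => He /eqP Hc Hc1.
have Hk1 : cap k.+1 eta z = 1 by have := cap_leS k eta z; lia.
have Hcar : 0 < carrier eta z by have := cap_le_carrier k.+1 eta z; lia.
have Hk' : cap k (bbs_step eta) z = k.
  by have := @cap_bbs_step_eq k eta z; rewrite Hc Hcar => /(_ isT).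
have Hk1' : cap k.+1 (bbs_step eta) z = k.
  have := cap_leS k (bbs_step eta) z; have := cap_bbs_step_le k.+1 eta z; lia.
have := slots_bbs_step k.+1 eta z.
rewrite !slotsS bbs_stepS (negbTE He) Hcar /= Hk1 Hk1' => ->.
by split; rewrite /=; lia.
Qed.

(** Seen at capacity [k], the same event takes place at a slot of both configurations, and the shift
    is [0 + k]. *)
Lemma drop_seat_slotsS k eta z : drop_seat k eta z ->
  [/\ slots k eta z.+1 = (slots k eta z).+1,
      slots k (bbs_step eta) z.+1 = (slots k (bbs_step eta) z).+1 &
      slots k (bbs_step eta) z.+1 = slots k eta z.+1 + k].
Proof.
case/and3P => He /eqP Hc Hc1.
have Hcar : 0 < carrier eta z by have := cap_le_carrier k.+1 eta z; lia.
have Hk' : cap k (bbs_step eta) z = k.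
  by have := @cap_bbs_step_eq k eta z; rewrite Hc Hcar => /(_ isT).
have := slots_bbs_step k eta z.
rewrite !slotsS bbs_stepS (negbTE He) Hcar /= Hc Hk' !eqxx => ->.
by split; rewrite /=; lia.
Qed.

(* Fillings of seat [k.+1] minus fillings of seat [k.+2]; since a soliton of
   size [j] fills each of the seats [1, ..., j] once, this counts the solitons of
   size [k.+1] up to a bounded error. *)
Definition msol (k : nat) (eta : config) (x : nat) : int :=
  (loads k.+1 eta x)%:Z + (loads k.+1 eta x)%:Z
  - (loads k eta x)%:Z - (loads k.+2 eta x)%:Z.

(* The correction that makes [msol] monotone; it vanishes at the [k.+1]-slots. *)
Definition pending (k : nat) (eta : config) (x : nat) : bool :=
  (cap k.+1 eta x == (cap k eta x).+1) && (cap k.+2 eta x == cap k.+1 eta x).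

Definition csol (k : nat) (eta : config) (x : nat) : int :=
  (msol k eta x - (pending k eta x)%:Z)%R.

Lemma csol_leS k eta x : (csol k eta x <= csol k eta x.+1)%R.
Proof.
have := cap_leS k eta x; have := cap_leS k.+1 eta x.
have := cap_le k eta x; have := cap_le k.+1 eta x; have := cap_le k.+2 eta x.
rewrite /csol /msol /pending /=; case: (eta _) => /=; lia.
Qed.

Lemma csol_homo k eta x y : x <= y -> (csol k eta x <= csol k eta y)%R.
Proof.
move=> /subnKC <-; elim: (y - x) => [|n IH]; first by rewrite addn0.
by rewrite addnS; apply: le_trans IH (csol_leS _ _ _).
Qed.

Lemma csol_bounds k eta x :
  (csol k eta x <= msol k eta x <= csol k eta x + 1)%R.
Proof. by rewrite /csol; case: pending; lia. Qed.

(** After a [k.+1]-slot, seats [k.+1] and [k.+2] are both occupied (the slot holds a ball) or both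
    empty (it holds none). *)
Lemma cap_slot_site k eta x : slot_site k.+1 eta x ->
  (cap k.+1 eta x) * 2 = cap k eta x + cap k.+2 eta x /\ ~~ pending k eta x.
Proof.
case: x => // x; rewrite /slot_site slotsS /pending.
have := cap_leS k eta x; have := cap_leS k.+1 eta x.
have := cap_le k eta x; have := cap_le k.+1 eta x; have := cap_le k.+2 eta x.
move=> H1 H2 H3 H4 H5 H6.
by move: H6 => /=; case: (eta _) => /=; case: eqP => ? /=; split; lia.
Qed.

Lemma csol_slot_site k eta x : slot_site k.+1 eta x ->
  csol k eta x = msol k eta x.
Proof.
by case/cap_slot_site => _ /negbTE H; rewrite /csol H subr0.
Qed.

(** Unloadings of seats [k.+1] and [k.+2] keep their place relative to the [k.+1]-slots when slot
    numbers are shifted by [k.+1]. Hence the same unloadings of [eta] precede [x] and [x']. *)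
Lemma msol_shift k eta x x' :
  slot_site k.+1 eta x -> slot_site k.+1 (bbs_step eta) x' ->
  slots k.+1 (bbs_step eta) x' = slots k.+1 eta x + k.+1 ->
  msol k (bbs_step eta) x' = msol k eta x.
Proof.
move=> Hx Hx' Hs.
have H1 : forall z, drop_seat k eta z -> (z < x') = (z < x).
  move=> z /drop_seat_slots[E1 E2 E3]; apply/idP/idP.
    move=> /(slot_site_lt Hx') H; rewrite ltnNge; apply/negP.
    move/(slots_homo k.+1 eta); lia.
  move=> /(slot_site_lt Hx) H; rewrite ltnNge; apply/negP.
  move/(slots_homo k.+1 (bbs_step eta)); lia.
have H2 : forall z, drop_seat k.+1 eta z -> (z < x') = (z < x).
  move=> z /drop_seat_slotsS[E1 E2 E3]; apply/idP/idP.
    move=> H; rewrite ltnNge; apply/negP => /= Hzx.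
    have := slots_homo k.+1 (bbs_step eta) H.
    have := slots_homo k.+1 eta Hzx; lia.
  move=> H; rewrite ltnNge; apply/negP => /= Hzx.
  have := slots_homo k.+1 eta H.
  have := slots_homo k.+1 (bbs_step eta) Hzx; lia.
have := unloads_diff_eq H1; have := unloads_diff_eq H2.
(* Fillings in [bbs_step eta] at [x'] are unloadings of [eta] at [x'], which may now be counted at
   [x]. There fillings and unloadings of [eta] differ by the contents, whose second difference
   vanishes at a slot. *)
have [H3 _] := cap_slot_site Hx.
rewrite /msol !loads_bbs_step !loadsE; lia.
Qed.

(** * Many time steps, and comparison at arbitrary sites *)

Definition slots_unbounded k eta := forall y, exists x, y <= slots k eta x.

Lemma slots_unbounded_iter k eta t :
  slots_unbounded k eta -> slots_unbounded k (iter t bbs_step eta).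
Proof.
move=> H; elim: t => // t IH y; have [x Hx] := IH y; exists x.
by rewrite /= slots_bbs_step; lia.
Qed.

Lemma msol_shift_iter k eta t x x' : slots_unbounded k.+1 eta ->
  slot_site k.+1 eta x -> slot_site k.+1 (iter t bbs_step eta) x' ->
  slots k.+1 (iter t bbs_step eta) x' = slots k.+1 eta x + k.+1 * t ->
  msol k (iter t bbs_step eta) x' = msol k eta x.
Proof.
move=> Hu Hx; elim: t x' => [|t IH] x' Hx' Hs.
  (* At time 0 both sites are slots with the same number, so they coincide. *)
  rewrite muln0 addn0 /= in Hs; congr (msol _ _ _); apply/eqP.
  rewrite eqn_leq; apply/andP; split; rewrite leqNgt; apply/negP.
    by move=> /(slot_site_lt Hx') /=; lia.
  by move=> /(slot_site_lt Hx) /=; lia.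
have [x'' Hx'' Hs''] := exists_slot_site
  (slots_unbounded_iter t Hu (slots k.+1 eta x + k.+1 * t)).
rewrite -(IH _ Hx'' Hs''); apply: msol_shift => //.
by rewrite Hs'' Hs; lia.
Qed.

Lemma last_slot_site k eta x :
  exists x0, [/\ slot_site k eta x0, x0 <= x & slots k eta x0 = slots k eta x].
Proof.
have [x0 H1 H2] := @exists_slot_site k eta (slots k eta x) (ex_intro _ x (leqnn _)).
exists x0; split => //; rewrite leqNgt; apply/negP => /(slot_site_lt H1).
by rewrite H2 ltnn.
Qed.

(** Exact transport holds at slot sites only. At other sites the monotone [csol] interpolates: [x]
    lies before the image of the last slot up to [x']. The error 1 is the [pending] correction. *)
Lemma msol_transport_le k eta t x x' : slots_unbounded k.+1 eta ->
  slots k.+1 (iter t bbs_step eta) x < slots k.+1 eta x' + k.+1 * t ->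
  (msol k (iter t bbs_step eta) x <= msol k eta x' + 1)%R.
Proof.
move=> Hu Hlt; have [x0 [Hx0 Hle Hs0]] := last_slot_site k.+1 eta x'.
have [x1 Hx1 Hs1] := exists_slot_site
  (slots_unbounded_iter t Hu (slots k.+1 eta x' + k.+1 * t)).
have Hxx1 : x <= x1.
  rewrite leqNgt; apply/negP => /ltnW/(slots_homo k.+1 (iter t bbs_step eta)).
  by rewrite Hs1 leqNgt Hlt.
have Heq := msol_shift_iter Hu Hx0 Hx1; rewrite Hs1 Hs0 in Heq.
have {}Heq := Heq erefl.
have := csol_homo k (iter t bbs_step eta) Hxx1; rewrite (csol_slot_site Hx1) Heq.
have := csol_homo k eta Hle; rewrite (csol_slot_site Hx0).
have := csol_bounds k (iter t bbs_step eta) x; have := csol_bounds k eta x'.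
lia.
Qed.

Lemma msol_transport_ge k eta t x x' : slots_unbounded k.+1 eta ->
  slots k.+1 eta x' + k.+1 * t < slots k.+1 (iter t bbs_step eta) x ->
  (msol k eta x' <= msol k (iter t bbs_step eta) x + 1)%R.
Proof.
move=> Hu Hlt.
(* The strict inequality leaves room for the next slot after [x']: its image still lies at or before
   [x]. *)
have [x0 Hx0 Hs0] := exists_slot_site (Hu (slots k.+1 eta x').+1).
have Hx'0 : x' <= x0.
  by rewrite leqNgt; apply/negP => /ltnW/(slots_homo k.+1 eta); lia.
have [x1 Hx1 Hs1] := exists_slot_site
  (slots_unbounded_iter t Hu ((slots k.+1 eta x').+1 + k.+1 * t)).
have Hx1x : x1 <= x.
  by rewrite leqNgt; apply/negP => /(slot_site_lt Hx1); lia.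
have Heq := msol_shift_iter Hu Hx0 Hx1; rewrite Hs1 Hs0 in Heq.
have {}Heq := Heq erefl.
have := csol_homo k (iter t bbs_step eta) Hx1x; rewrite (csol_slot_site Hx1) Heq.
have := csol_homo k eta Hx'0; rewrite (csol_slot_site Hx0).
have := csol_bounds k (iter t bbs_step eta) x; have := csol_bounds k eta x'.
lia.
Qed.

(** * The soliton decomposition as a stack algorithm *)

Definition run_val (r : seq sv) : bool := (head (0, false) r).2.
Definition run_site (r : seq sv) : nat := (head (0, false) r).1.

(* A stack lists the runs not yet removed, the most recent one first. *)
Definition push (a : sv) (st : seq (seq sv)) : seq (seq sv) :=
  if st is r :: st' then
    if a.2 == run_val r then rcons r a :: st' else [:: a] :: st
  else [:: [:: a]].

Definition collapse (st : seq (seq sv)) : seq (seq sv) :=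
  if st is r :: q :: st' then if size q <= size r then st' else st else st.

Definition collapsed (st : seq (seq sv)) : seq (nat * nat) :=
  if st is r :: q :: _ then
    if size q <= size r then [:: (size q, run_site q)] else [::]
  else [::].

Definition at_record (eta : config) (x : nat) (st : seq (seq sv)) : bool :=
  nilp st && ~~ eta x.

Fixpoint stack (eta : config) (x : nat) : seq (seq sv) :=
  if x is x'.+1 then
    let st := stack eta x' in
    if at_record eta x st then [::] else collapse (push (x, eta x) st)
  else [::].

Fixpoint solitons (eta : config) (x : nat) : seq (nat * nat) :=
  if x is x'.+1 then
    let st := stack eta x' in
    solitons eta x' ++
      (if at_record eta x st then [::] else collapsed (push (x, eta x) st))
  else [::].

Definition well_run (r : seq sv) : bool :=
  all (fun a : sv => a.2 == run_val r) r && (0 < size r).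

(** These are the states without a removable pair: lengths decrease strictly towards the top and
    values alternate. The bottom run consists of balls, since an empty site read on an empty stack
    is a record. *)
Fixpoint valid (st : seq (seq sv)) : bool :=
  if st is r :: st' then
    [&& well_run r, valid st' &
        (if st' is q :: _ then (size r < size q) && (run_val q == ~~ run_val r)
         else run_val r)]
  else true.

(** Reading one site lengthens the top run by one or starts a new run of length 1, so a tie with the
    run below is the only possible defect. It signals a completed soliton. *)
Definition prevalid (st : seq (seq sv)) : bool :=
  if st is r :: st' then
    [&& well_run r, valid st' &
        (if st' is q :: _ then (size r <= size q) && (run_val q == ~~ run_val r)
         else run_val r)]
  else false.

Lemma run_val_rcons r a : 0 < size r -> run_val (rcons r a) = run_val r.
Proof. by case: r. Qed.

Lemma run_site_rcons r a : 0 < size r -> run_site (rcons r a) = run_site r.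
Proof. by case: r. Qed.

Lemma well_run_rcons r a : well_run r -> a.2 = run_val r -> well_run (rcons r a).
Proof.
case/andP => Hall Hs Ha; rewrite /well_run run_val_rcons // size_rcons all_rcons.
by rewrite Ha eqxx Hall.
Qed.

Lemma push_prevalid a st : valid st -> ~~ (nilp st && ~~ a.2) ->
  prevalid (push a st).
Proof.
case: st => [|r st] /=; first by rewrite /well_run /run_val /= eqxx /= => _; case: a.2.
case/and3P => Hr Hst Hq _; have Hs : 0 < size r by case/andP: Hr.
case: eqP => Ha /=.
  rewrite well_run_rcons // Hst; case: st Hq {Hst} => [|q st] /=.
    by rewrite run_val_rcons.
  by rewrite run_val_rcons // size_rcons.
rewrite Hr Hst Hq Hs /= /well_run /run_val /= eqxx /=.
by move: Ha; rewrite /run_val; case: a.2; case: (head _ r).2.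
Qed.

Lemma prevalidP st : prevalid st ->
  (valid st /\ collapse st = st /\ collapsed st = [::]) \/
  (exists r q st', [/\ st = r :: q :: st', size r = size q,
     valid (q :: st'), well_run r /\ run_val q = ~~ run_val r &
     collapse st = st' /\ collapsed st = [:: (size q, run_site q)]]).
Proof.
case: st => // r [|q st]; first by left.
move=> /= /and3P[Hr Hst /andP[Hle /eqP Hv]].
case: (ltngtP (size r) (size q)) => Hc; [left | lia | right].
  by rewrite Hr Hst Hv eqxx.
by exists r, q, st; split.
Qed.

Lemma stack_valid eta x : valid (stack eta x).
Proof.
elim: x => //= x IH; case: ifP => // /negbT Hrec.
have /prevalidP := @push_prevalid (x.+1, eta x.+1) _ IH Hrec.
case=> [[H [-> _]] //|[r [q [st [_ _ + _ [-> _]]]]]].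
by case/and3P.
Qed.

(* The alternating sum of the run lengths, truncated at [k], is [cap k]. *)
Fixpoint alt (k : nat) (st : seq (seq sv)) : nat :=
  if st is r :: st' then
    if run_val r then alt k st' + minn (size r) k else alt k st' - minn (size r) k
  else 0.

(** This counts the sites of the stacked runs that are not [k]-slots. *)
Fixpoint tot (k : nat) (st : seq (seq sv)) : nat :=
  if st is r :: st' then tot k st' + minn (size r) k else 0.

(** Since lengths grow towards the bottom, a top run of length at least [k] means that all truncated
    lengths equal [k], and the alternating sum is at an end of [[0, k]]. This decides whether
    prolonging the top run creates a slot. *)
Lemma alt_valid k r st : valid (r :: st) ->
  if run_val r then
    (minn (size r) k <= alt k (r :: st) <= k) &&
    ((alt k (r :: st) == k) == (k <= size r))
  else (alt k (r :: st) + minn (size r) k <= k) &&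
    ((alt k (r :: st) == 0) == (k <= size r)).
Proof.
elim: st r => [|q st IH] r; first by move=> /= /andP[_ ->]; lia.
move=> H; have {H} : [&& well_run r, valid (q :: st), size r < size q &
  run_val q == ~~ run_val r] by [].
case/and4P => _ /IH + Hlt /eqP Hv; move: Hlt; set l := size r; set l' := size q => Hlt.
have -> : alt k [:: r, q & st] = if run_val r then alt k (q :: st) + minn l k
  else alt k (q :: st) - minn l k by [].
rewrite Hv; case: (run_val r) => /=; rewrite ?Hv -/l'; lia.
Qed.

Lemma alt_tot_push k a st : valid st -> ~~ (nilp st && ~~ a.2) ->
  alt k (push a st) = (if a.2 then minn (alt k st).+1 k else (alt k st).-1) /\
  tot k (push a st) + (if a.2 then alt k st == k else alt k st == 0)
    = (tot k st).+1.
Proof.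
case: st => [|r st]; first by move=> _ /=; rewrite /run_val /=; case: a.2 => //= _; lia.
move=> Hv _; have := alt_valid k Hv.
have Hs : 0 < size r by case/and3P: Hv => /andP[].
rewrite /=; case: (a.2 =P run_val r) => Ha /=.
  rewrite run_val_rcons // -Ha size_rcons; case: a.2; lia.
have -> : run_val [:: a] = a.2 by [].
by move: Ha; case: a.2; case: (run_val r) => //= _; split; lia.
Qed.

(** Under a run of empty sites the subtraction in [alt] is never cut off at 0, so adding a run of
    balls of the same length undoes it. *)
Lemma alt_pop k q st : valid (q :: st) -> ~~ run_val q ->
  minn (size q) k <= alt k st.
Proof.
case: st => [|p st]; first by move=> /= /andP[_ ->].
move=> H Hq; have {H} : [&& well_run q, valid (p :: st), size q < size p &
  run_val p == ~~ run_val q] by [].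
case/and4P => _ /(alt_valid k) + Hlt /eqP Hv; rewrite Hv Hq => /andP[/andP[H _] _].
by apply: leq_trans H; lia.
Qed.

(** The removed runs have equal lengths and opposite values: they cancel in [alt], and their sites
    pass from [tot] to the soliton sum. *)
Lemma alt_collapse k st : prevalid st ->
  alt k (collapse st) = alt k st /\
  tot k (collapse st) + \sum_(p <- collapsed st) 2 * minn p.1 k = tot k st.
Proof.
move=> /prevalidP[[_ [-> ->]]|]; first by rewrite big_nil addn0.
case=> r [q [st' [-> Hs Hv [_ Hqr] [-> ->]]]].
rewrite big_seq1 /= Hs; have := alt_pop k Hv; rewrite Hqr.
by case: (run_val r) => /= H; split; rewrite ?subnK ?addnK ?H //; lia.
Qed.

Lemma alt_stack k eta x : alt k (stack eta x) = cap k eta x.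
Proof.
elim: x => // x IH; rewrite /=; case: (boolP (at_record _ _ _)) => [/andP[/nilP Hn He]|Hrec].
  by rewrite -IH Hn (negbTE He).
have [H1 _] := alt_collapse k (push_prevalid (a := (x.+1, eta x.+1)) (stack_valid eta x) Hrec).
by rewrite H1; have [-> _] := alt_tot_push k (a := (x.+1, eta x.+1)) (stack_valid eta x) Hrec;
   rewrite IH.
Qed.

(* A soliton of size [j] occupies [2 * minn j k] sites that are not [k]-slots. *)
Lemma slots_solitons k eta x :
  slots k eta x + \sum_(p <- solitons eta x) 2 * minn p.1 k + tot k (stack eta x)
    = x.
Proof.
elim: x => [|x IH]; first by rewrite /= big_nil.
rewrite [solitons _ _]/= [stack _ _]/= slotsS big_cat /=.
case: (boolP (at_record _ _ _)) => [/andP[/nilP Hn He]|Hrec].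
  rewrite big_nil (negbTE He) -alt_stack /= Hn /=.
  by move: IH; rewrite Hn /=; lia.
have [_ H1] := alt_collapse k (push_prevalid (a := (x.+1, eta x.+1)) (stack_valid eta x) Hrec).
have [_ H2] := alt_tot_push k (a := (x.+1, eta x.+1)) (stack_valid eta x) Hrec.
rewrite /= in H2; rewrite -!alt_stack; move: H1 H2 IH.
case: (eta x.+1) => /=; lia.
Qed.

(** * Records as the moments when an empty site meets an empty carrier *)

Lemma carrier_le eta x : carrier eta x <= x.
Proof. by elim: x => //= x; case: (eta _); case: (carrier eta x) => [|c] /=; lia. Qed.

Lemma cap_carrier k eta x : x <= k -> cap k eta x = carrier eta x.
Proof.
elim: x => //= x IH Hx; rewrite IH; last lia.
by have := carrier_le eta x; case: (eta _); case: (carrier eta x) => [|c] /=; lia.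
Qed.

Lemma stack_nil eta x : nilp (stack eta x) = (carrier eta x == 0).
Proof.
apply/idP/idP => [/nilP H|/eqP H].
  by rewrite -(cap_carrier (k := x) eta) // -alt_stack H.
case E : (stack eta x) => [//|r st]; have := stack_valid eta x; rewrite E => Hv.
(* With capacity one above the length of the top run, [alt] is positive whatever the value of that
   run. *)
have := alt_valid (size r).+1 Hv; rewrite -E alt_stack.
have Hs : 0 < size r by case/and3P: Hv => /andP[].
have := cap_le_carrier (size r).+1 eta x; case: (run_val r); lia.
Qed.

Lemma SpathS eta x :
  Spath eta x.+1 = (Spath eta x + (1 - 2 * (nat_of_bool (eta x.+1))%:Z))%R.
Proof. by rewrite /Spath big_nat_recr. Qed.

(** The carrier content is the path reflected at its running maximum. *)
Lemma Mpath_carrier eta x : Mpath eta x = (Spath eta x + (carrier eta x)%:Z)%R.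
Proof.
elim: x => [|x IH]; first by rewrite /= addr0.
rewrite [Mpath _ _]/= IH SpathS /=.
by case: (eta _); case: (carrier eta x) => [|c] /=; lia.
Qed.

Lemma is_recordS eta x : is_record eta x.+1 = ~~ eta x.+1 && (carrier eta x == 0).
Proof.
rewrite /is_record [x.+1.-1]/= [Mpath _ x.+1]/= Mpath_carrier SpathS orFb.
by case: (eta _); case: (carrier eta x) => [|c] /=; lia.
Qed.

Lemma at_recordE eta x : at_record eta x.+1 (stack eta x) = is_record eta x.+1.
Proof. by rewrite /at_record is_recordS stack_nil andbC. Qed.

Lemma stack_record eta x : is_record eta x -> stack eta x = [::].
Proof. by case: x => // x; rewrite -at_recordE /= => ->. Qed.

(** * Runs of a concatenation and a single removal step *)

Lemma runs_cons a s : exists r rs, runs (a :: s) = (a :: r) :: rs.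
Proof.
rewrite /=; case: (runs s) => [|[|b r] rs].
- by exists [::], [::].
- by exists [::], [::].
by case: ifP => _; [exists (b :: r), rs | exists [::], ((b :: r) :: rs)].
Qed.

Lemma flatten_runs s : flatten (runs s) = s.
Proof.
elim: s => // a [|b s] IH //; have [r [rs E]] := runs_cons b s.
by rewrite [runs _]/= -/(runs (b :: s)) E /=; case: ifP => _ /=; rewrite -{}IH E.
Qed.

Lemma runs_cat_opp r (t : seq sv) : well_run r -> t != [::] -> run_val t = ~~ run_val r ->
  runs (r ++ t) = r :: runs t.
Proof.
rewrite /well_run; move: (run_val r) => c /andP[Hall Hs] Ht Hv.
elim: r Hs Hall => // a r IH _ /= /andP[/eqP Ha Hall].
case: r IH Hall => [|a' r] IH Hall.
  rewrite /=; case: t Ht Hv IH => // d t _ Hv IH.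
  have [p [rs ->]] := runs_cons d t.
  by move: Hv; rewrite /run_val /= Ha => ->; case: c {Ha Hall IH}.
rewrite IH //=; case/andP: Hall => /eqP -> _.
by rewrite Ha eqxx.
Qed.

Lemma runs_well r : well_run r -> runs r = [:: r].
Proof.
rewrite /well_run; move: (run_val r) => c /andP[Hall Hs].
elim: r Hs Hall => // a r IH _ /= /andP[/eqP Ha Hall].
case: r IH Hall => [|a' r] IH Hall //.
rewrite IH //=; case/andP: Hall => /eqP -> _.
by rewrite Ha eqxx.
Qed.

(** The unread part may prolong [r]; [p] is this continuation. *)
Lemma runs_cat r s : well_run r ->
  exists p rs, runs (r ++ s) = (r ++ p) :: rs /\ p ++ flatten rs = s.
Proof.
rewrite /well_run; move: (run_val r) => c /andP[Hall Hs].
elim: r Hs Hall => // a r IH _ /= /andP[/eqP Ha Hall].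
case: r IH Hall => [|a' r] IH Hall.
  case: s {IH Hall} => [|d s]; first by exists [::], [::].
  have := flatten_runs (d :: s); have [q [rs E]] := runs_cons d s.
  rewrite [runs (_ ++ _)]/= -/(runs (d :: s)) E /= => Hf.
  by case: ifP => _; [exists (d :: q), rs | exists [::], ((d :: q) :: rs)].
have [p [rs [E1 E2]]] := IH isT Hall.
exists p, rs; split => //; rewrite [_ ++ _]/= in E1 *.
rewrite E1 /=; case/andP: Hall => /eqP -> _.
by rewrite Ha eqxx.
Qed.

Lemma runs_stack r st (t : seq sv) : valid (r :: st) -> t != [::] -> run_val t = ~~ run_val r ->
  runs (flatten (rev (r :: st)) ++ t) = rev (r :: st) ++ runs t.
Proof.
elim: st r t => [|q st IH] r t.
  by move=> /= /andP[Hr _] Ht Hv; rewrite /= cats0; apply: runs_cat_opp.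
move=> H Ht Hv; have {H} : [&& well_run r, valid (q :: st), size r < size q &
  run_val q == ~~ run_val r] by [].
case/and4P => Hr Hst _ /eqP Hq.
rewrite rev_cons -cats1 flatten_cat /= cats0 -!catA IH //.
- by rewrite runs_cat_opp.
- by case: r Hr {Hv Hq}.
by case: r Hr Hq {Hv} => // a r _ ->; rewrite negbK.
Qed.

Lemma valid_sorted st : valid st -> sorted gtn (map size (rev st)).
Proof.
rewrite map_rev rev_sorted; elim: st => // r [|q st] IH // /and3P[_ Hv /andP[Hs _]].
by have /= := IH Hv; rewrite Hs => ->.
Qed.

Definition small_first (p : seq sv * seq sv) : bool := size p.1 <= size p.2.

Lemma find_desc (l : seq (seq sv)) q r rest :
  sorted gtn (map size (rcons l q)) -> size q <= size r ->
  find small_first (zip (l ++ q :: r :: rest) (behead (l ++ q :: r :: rest)))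
    = size l.
Proof.
elim: l => [|a l IH] /= Hs Hqr; first by rewrite /small_first /= Hqr.
case: l IH Hs => [|b l] IH /= Hs.
  have := IH isT Hqr; rewrite /= => ->.
  by case/andP: Hs => Hs _; rewrite /small_first /= leqNgt Hs.
have := IH (proj2 (andP Hs)) Hqr; rewrite /= => ->.
by case/andP: Hs => Hs _; rewrite /small_first /= leqNgt Hs.
Qed.

Lemma has_desc (l : seq (seq sv)) : sorted gtn (map size l) ->
  has small_first (zip l (behead l)) = false.
Proof.
elim: l => // a [|b l] IH //= /andP[H1 H2].
by have /= := IH H2; rewrite /small_first /= => ->; rewrite orbF leqNgt H1.
Qed.

Lemma soliton_step_valid st : valid st -> soliton_step (flatten (rev st)) = None.
Proof.
move=> Hv; have -> : soliton_step (flatten (rev st)) =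
    let rs := rev st in
    let pairs := zip rs (behead rs) in
    let k := find small_first pairs in
    if k < size pairs then
      let r1 := nth [::] rs k in
      let r2 := nth [::] rs k.+1 in
      Some ((size r1, (head (0, false) r1).1),
          flatten (take k rs) ++ drop (size r1) r2 ++ flatten (drop k.+2 rs))
    else None.
  rewrite /soliton_step; suff -> : runs (flatten (rev st)) = rev st by [].
  case: st Hv => // r st; case: st => [|q st].
    by move=> /= /andP[Hr _]; rewrite cats0; apply: runs_well.
  move=> H; have {H} : [&& well_run r, valid (q :: st), size r < size q &
    run_val q == ~~ run_val r] by [].
  case/and4P => Hr Hst _ /eqP Hq.
  rewrite rev_cons -cats1 flatten_cat /= cats0 runs_stack //.
  - by rewrite runs_well.
  - by case: r Hr {Hq}.
  by rewrite Hq negbK.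
by rewrite /= -has_find has_desc // valid_sorted.
Qed.

(** The unread sites [s] can only lengthen the run after [q], which is already long enough, and
    lengths decrease strictly up to [q]. The left-most removable pair is therefore settled before
    [s] is read. *)
Lemma soliton_step_collapse r q st s : valid (q :: st) -> well_run r ->
  size r = size q -> run_val q = ~~ run_val r ->
  soliton_step (flatten (rev (r :: q :: st)) ++ s) =
    Some ((size q, run_site q), flatten (rev st) ++ s).
Proof.
move=> Hv Hr Hs Hq.
have [p [rs [E1 E2]]] := runs_cat s Hr.
have E : runs (flatten (rev (r :: q :: st)) ++ s) = rev st ++ q :: (r ++ p) :: rs.
  rewrite rev_cons -cats1 flatten_cat /= cats0 -catA runs_stack //.
  - by rewrite E1 rev_cons cat_rcons.
  - by case: r Hr {Hs Hq E1}.
  by case: r Hr Hq {Hs E1} => // a r _ ->; rewrite negbK.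
have Hf : find small_first (zip (runs (flatten (rev (r :: q :: st)) ++ s))
    (behead (runs (flatten (rev (r :: q :: st)) ++ s)))) = size st.
  rewrite E find_desc ?size_rev //.
    by rewrite -rev_cons valid_sorted.
  by rewrite size_cat Hs leq_addr.
rewrite /soliton_step -/small_first.
rewrite [find _ _]Hf E size_zip size_behead size_cat /= size_rev.
have -> : size st < minn (size st + (size rs).+2) (size st + (size rs).+2).-1 by lia.
rewrite !nth_cat size_rev ltnn subnn /= ltnNge leqnSn /= subSnn /=.
congr (Some (_, _)); rewrite take_cat size_rev ltnn subnn take0 cats0.
rewrite [drop _.+2 _]drop_cat size_rev ltnNge (leq_trans (leqnSn _) (leqnSn _)) /=.
have -> : (size st).+2 - size st = 2 by lia.
rewrite /= drop0 drop_cat Hs ltnn subnn drop0.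
by rewrite E2.
Qed.

Lemma flatten_rev_push a st :
  flatten (rev (push a st)) = rcons (flatten (rev st)) a.
Proof.
case: st => [|r st] //=; case: ifP => _; rewrite !rev_cons -!cats1 !flatten_cat /= ?cats0.
  by rewrite catA.
by [].
Qed.

Lemma segmentS eta x x1 : x.+1 < x1 ->
  segment eta x x1 = (x.+1, eta x.+1) :: segment eta x.+1 x1.
Proof. by move=> H; rewrite /segment (_ : x1 - x.+1 = (x1 - x.+2).+1) //; lia. Qed.

(* Reading the sites from left to right and emitting a soliton as soon as it
   is complete performs the removals in the order of the decomposition. *)
Lemma soliton_decomp_fuelE eta x x1 f : x < x1 ->
  (forall y, x < y < x1 -> ~~ is_record eta y) ->
  size (flatten (rev (stack eta x)) ++ segment eta x x1) <= f ->
  solitons eta x1.-1 = solitons eta x ++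
    soliton_decomp_fuel f (flatten (rev (stack eta x)) ++ segment eta x x1).
Proof.
move En : (x1.-1 - x) => n; elim: n x f En => [|n IH] x f En Hx Hrec Hf.
  have Ex : x = x1.-1 by lia.
  have -> : segment eta x x1 = [::] by rewrite /segment (_ : x1 - x.+1 = 0) //; lia.
  rewrite cats0; case: f Hf => [|f] _ /=; first by rewrite cats0 -Ex.
  by rewrite soliton_step_valid ?stack_valid // cats0 -Ex.
have Hx' : x.+1 < x1 by lia.
have Hnr : ~~ is_record eta x.+1 by apply: Hrec; lia.
have Hnr' : at_record eta x.+1 (stack eta x) = false by rewrite at_recordE (negbTE Hnr).
have Hrec' : forall y, x.+1 < y < x1 -> ~~ is_record eta y by move=> y Hy; apply: Hrec; lia.
have Hpv := push_prevalid (a := (x.+1, eta x.+1)) (stack_valid eta x) (negbT Hnr').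
move: Hf; rewrite segmentS // -cat_rcons -flatten_rev_push => Hf.
have Hst : stack eta x.+1 = collapse (push (x.+1, eta x.+1) (stack eta x)).
  by rewrite /= Hnr'.
have Hso : solitons eta x.+1 = solitons eta x ++ collapsed (push (x.+1, eta x.+1) (stack eta x)).
  by rewrite /= Hnr'.
case: (prevalidP Hpv) => [[Hv [E1 E2]]|].
  have := IH x.+1 f; rewrite Hst Hso E1 E2 cats0; apply => //; lia.
case=> r [q [st' [Ep Hs Hv [Hr Hqr] [E1 E2]]]].
move: Hf; rewrite Ep; set S := segment eta x.+1 x1.
(* The removal deletes [2 * size q] entries, a positive number, which pays for the unit of fuel. *)
have Hq : 0 < size q by case/and3P: Hv => /andP[].
rewrite !rev_cons -!cats1 !flatten_cat /= !cats0 !size_cat => Hf.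
case: f Hf => [|f] Hf; first lia.
have := @soliton_step_collapse r q st' S Hv Hr Hs Hqr.
rewrite !rev_cons -!cats1 !flatten_cat /= !cats0 => ->.
have := IH x.+1 f; rewrite Hst Hso E1 E2 -catA /=; apply => //; first lia.
rewrite size_cat -/S; lia.
Qed.

Lemma soliton_decompE eta x0 x1 : consecutive_records eta x0 x1 ->
  solitons eta x1.-1 = solitons eta x0 ++ soliton_decomp (segment eta x0 x1).
Proof.
case=> H0 _ Hlt Hrec; rewrite /soliton_decomp.
have := @soliton_decomp_fuelE eta x0 x1 (size (segment eta x0 x1)) Hlt Hrec.
by rewrite stack_record //= => ->.
Qed.

Lemma solitons_prefix eta x y : x <= y ->
  exists s, solitons eta y = solitons eta x ++ s.
Proof.
move=> /subnKC <-; elim: (y - x) => [|n [s IH]].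
  by exists [::]; rewrite addn0 cats0.
by rewrite addnS /= IH -catA; eexists.
Qed.

Lemma solitons_sub eta x y : x <= y -> {subset solitons eta x <= solitons eta y}.
Proof. by case/(solitons_prefix eta) => s -> p; rewrite mem_cat => ->. Qed.

Definition inf_records (eta : config) := forall x, exists2 y, x < y & is_record eta y.

(** Infinitely many records put every emitted soliton into a finished block between consecutive
    records, so one left-to-right pass describes all blocks at once. *)
Lemma has_solitonP eta i x : inf_records eta ->
  has_soliton eta i x <-> exists y, (i, x) \in solitons eta y.
Proof.
move=> Hinf; split.
  case=> x0 [x1 [Hc Hin]]; exists x1.-1.
  by rewrite (soliton_decompE Hc) mem_cat Hin orbT.
case=> y; elim: y => // y IH; rewrite /= mem_cat => /orP[/IH //|].
case: ifP => // Hnr; rewrite at_recordE in Hnr => Hin.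
(* The block runs from the last record up to [y] to the first record after [y]; the emission at
   [y.+1] shows that this site is not a record. *)
have [x0 [Hx0 Hlt Hmax]] : exists x0, [/\ is_record eta x0, x0 <= y &
    forall z, x0 < z <= y -> ~~ is_record eta z].
  elim: (y) => [|n [x0 [H1 H2 H3]]]; first by exists 0; split => // z; lia.
  case Hr : (is_record eta n.+1); first by exists n.+1; split => // z; lia.
  exists x0; split => //; first lia.
  move=> z Hz; case: (eqVneq z n.+1) => [->|]; first by rewrite Hr.
  by move=> Hne; apply: H3; lia.
have Hex : exists z, (y < z) && is_record eta z by have [z ? ?] := Hinf y; exists z; apply/andP.
case: (ex_minnP Hex) => x1 /andP[Hy Hx1] Hmin.
have Hyx1 : y.+1 < x1.
  by rewrite ltn_neqAle Hy andbT; apply/eqP => E; move: Hx1; rewrite -E Hnr.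
have Hc : consecutive_records eta x0 x1.
  split => //; first lia.
  move=> z Hz; case: (leqP z y) => Hzy; first by apply: Hmax; lia.
  by apply/negP => Hz'; have := Hmin z; rewrite Hzy Hz' => /(_ isT); lia.
exists x0, x1; split => //.
have [s1 Es1] := solitons_prefix eta Hlt.
have [s2 Es2] := solitons_prefix eta (ltac:(lia) : y.+1 <= x1.-1).
have := soliton_decompE Hc; rewrite Es2 /= at_recordE Hnr Es1 -!catA.
move/(congr1 (drop (size (solitons eta x0)))); rewrite !drop_size_cat // => <-.
by rewrite !mem_cat Hin orbT.
Qed.

(** * Transport of soliton counts *)

(** The left-most sites of completed solitons together with those of the runs that may still start
    one. *)
Definition sites (eta : config) (x : nat) : seq nat :=
  map snd (solitons eta x) ++ map run_site (stack eta x).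

Lemma sitesS eta x : exists L, subseq (sites eta x.+1) L /\
  (L = sites eta x \/ perm_eq L (x.+1 :: sites eta x)).
Proof.
rewrite /sites /=; case: (boolP (at_record _ _ _)) => [|Hrec].
  case/andP => /nilP -> _; rewrite !cats0.
  by exists (map snd (solitons eta x)); split; [exact: subseq_refl | left].
exists (map snd (solitons eta x) ++
        map run_site (push (x.+1, eta x.+1) (stack eta x))); split.
  have /prevalidP := push_prevalid (a := (x.+1, eta x.+1)) (stack_valid eta x) Hrec.
  case=> [[_ [-> ->]]|]; first by rewrite cats0.
  case=> r [q [st' [-> _ _ _ [-> ->]]]].
  rewrite map_cat -catA; apply: cat_subseq; first exact: subseq_refl.
  exact: subseq_cons.
have := stack_valid eta x; case: (stack eta x) => [|r st] /=.
  by move=> _; right; rewrite cats0 perm_catC.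
case/and3P => /andP[_ Hr] _ _; case: ifP => _ /=.
  by left; rewrite run_site_rcons.
by right; apply/permEl; exact: (perm_catCA _ [:: x.+1] _).
Qed.

Lemma sites_uniq eta x : uniq (sites eta x) /\ {in sites eta x, forall y, 0 < y <= x}.
Proof.
elim: x => [|x [IHu IHb]]; first by [].
have [L [HL HL']] := sitesS eta x.
have [Hu Hb] : uniq L /\ {in L, forall y, 0 < y <= x.+1}.
  case: HL' => [->|Hp].
    by split => // y /IHb; lia.
  rewrite (perm_uniq Hp) /= IHu andbT; split.
    by apply/negP => /IHb; lia.
  by move=> y; rewrite (perm_mem Hp) inE => /orP[/eqP ->|/IHb]; lia.
split; first exact: subseq_uniq HL Hu.
by move=> y /(mem_subseq HL)/Hb.
Qed.

(** Only the site being read can enter [sites], so an old entry was there already. *)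
Lemma sites_old eta x y z : x <= y -> z \in sites eta y -> z <= x ->
  z \in sites eta x.
Proof.
move=> /subnKC <- + Hz; elim: (y - x) => [|n IH]; first by rewrite addn0.
rewrite addnS => Hin; apply: IH; have [L [/mem_subseq/(_ _ Hin) HL]] := sitesS eta (x + n).
case=> [<- //|/perm_mem Hp]; move: HL; rewrite Hp inE => /orP[/eqP|//].
by lia.
Qed.

Lemma sigma_sum eta i x t : \sum_(1 <= y < x.+1) sigma eta i y t =
  size [seq y <- iota 1 x | `[< has_soliton (iter t bbs_step eta) i y >]].
Proof.
rewrite size_filter /index_iota subSS subn0 -sum1_count [RHS]big_mkcond /=.
by [].
Qed.

(** A soliton that starts by [x] but is completed later begins with a run still on the stack at [x].
    The stack size therefore bounds the excess. *)
Lemma sigma_sum_bounds eta i x t : inf_records (iter t bbs_step eta) ->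
  count (fun p => p.1 == i) (solitons (iter t bbs_step eta) x)
    <= \sum_(1 <= y < x.+1) sigma eta i y t
    <= count (fun p => p.1 == i) (solitons (iter t bbs_step eta) x)
       + size (stack (iter t bbs_step eta) x).
Proof.
rewrite sigma_sum; set zeta := iter t bbs_step eta => Hinf.
set E := [seq p <- solitons zeta x | p.1 == i].
have [Hu Hb] := sites_uniq zeta x.
have HuE : uniq (map snd E).
  move: Hu; rewrite cat_uniq => /andP[+ _].
  by apply: subseq_uniq; apply: map_subseq; apply: filter_subseq.
rewrite -size_filter -/E; apply/andP; split.
  rewrite -(size_map snd E); apply: uniq_leq_size => // y /mapP[[j y'] + /= ->].
  rewrite mem_filter /= => /andP[/eqP -> Hin].
  rewrite mem_filter mem_iota; apply/andP; split.
    by apply/asboolP/(has_solitonP _ _ Hinf); exists x.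
  have : y' \in sites zeta x.
    by rewrite mem_cat; apply/orP; left; apply/mapP; exists (i, y').
  by move/Hb; lia.
rewrite -(size_map snd E) -(size_map run_site) -size_cat.
apply: uniq_leq_size; first by rewrite filter_uniq // iota_uniq.
move=> y; rewrite mem_filter mem_iota => /andP[/asboolP/(has_solitonP _ _ Hinf) [X HX] Hy].
case: (leqP X x) => HXx.
  rewrite mem_cat; apply/orP; left; apply/mapP; exists (i, y) => //.
  by rewrite mem_filter eqxx /=; exact: solitons_sub HXx _ HX.
have : y \in sites zeta x.
  apply: (@sites_old zeta x X); [exact: ltnW | | lia].
  by rewrite mem_cat; apply/orP; left; apply/mapP; exists (i, y).
rewrite !mem_cat => /orP[|->]; last by rewrite orbT.
case/mapP => [[j y']] Hj /= Ey; rewrite -{}Ey in Hj.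
apply/orP; left; apply/mapP; exists (j, y) => //; rewrite mem_filter Hj andbT /=.
have {}Hj := solitons_sub (ltnW HXx) Hj.
have [HuX _] := sites_uniq zeta X; move: HuX; rewrite cat_uniq => /andP[HuX _].
(* Left-most sites are distinct, so [y] cannot start solitons of two sizes [i] and [j]. *)
have /= := uniqP (0 : nat) HuX (index (j, y) (solitons zeta X)) (index (i, y) (solitons zeta X)).
rewrite !inE !size_map !index_mem Hj HX => /(_ isT isT).
rewrite !(nth_map (0, 0)) ?index_mem // !nth_index // => /(_ erefl) Hidx.
have := nth_index (0, 0) Hj; rewrite Hidx nth_index //.
by case=> ->.
Qed.

(** * Persistence of infinitely many records *)

Lemma Mpath_carrierS eta x :
  Mpath eta x.+1 = (Mpath eta x + (is_record eta x.+1)%:Z)%R.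
Proof.
rewrite is_recordS !Mpath_carrier SpathS /=.
by case: (eta _); case: (carrier eta x) => [|c] /=; lia.
Qed.

Lemma Mpath_le_slots k eta x : (Mpath eta x <= (slots k eta x)%:Z)%R.
Proof.
elim: x => [|x IH]; first by rewrite /= /Spath big_geq.
rewrite Mpath_carrierS is_recordS slotsS; have := cap_le_carrier k eta x.
case: (eta _) => /=; lia.
Qed.

(** Before site [k] the capacity does not bind, and the slots are exactly the records. *)
Lemma Mpath_slots k eta x : x < k -> Mpath eta x = (slots k eta x)%:Z%R.
Proof.
elim: x => [|x IH] Hx; first by rewrite /= /Spath big_geq.
rewrite Mpath_carrierS is_recordS slotsS IH ?cap_carrier; try lia.
have := carrier_le eta x; case: (eta _) => /=; lia.
Qed.

Definition Mpath_unbounded eta := forall y : nat, exists x, (y%:Z <= Mpath eta x)%R.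

Lemma Omega_unbounded eta : Omega eta -> Mpath_unbounded eta.
Proof.
move=> H y; have [x _ Hx] := H y%:Z%R 0; exists x.
by rewrite Mpath_carrier; lia.
Qed.

(** At capacity [x.+1] the running maximum at [x] is a slot number, and a step never lowers slot
    numbers. *)
Lemma Mpath_unbounded_iter eta t :
  Mpath_unbounded eta -> Mpath_unbounded (iter t bbs_step eta).
Proof.
move=> H; elim: t => // t IH y; have [x Hx] := IH y; exists x.
rewrite /= (@Mpath_slots x.+1) // slots_bbs_step.
by move: Hx; rewrite (@Mpath_slots x.+1) //; lia.
Qed.

Lemma Mpath_unbounded_slots k eta : Mpath_unbounded eta -> slots_unbounded k eta.
Proof.
move=> H y; have [x Hx] := H y; exists x.
by have := Mpath_le_slots k eta x; lia.
Qed.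

Lemma Mpath_unbounded_records eta : Mpath_unbounded eta -> inf_records eta.
Proof.
move=> H x; case: (boolP `[< exists2 y, x < y & is_record eta y >]) => [/asboolP //|/asboolP Hn].
exfalso; have Hc : forall n, Mpath eta (x + n) = Mpath eta x.
  elim=> [|n IH]; first by rewrite addn0.
  rewrite addnS Mpath_carrierS IH; case Hr : (is_record _ _); last by rewrite addr0.
  by case: Hn; exists (x + n).+1 => //; lia.
have Hmono y : y <= x -> (Mpath eta y <= Mpath eta x)%R.
  move=> /subnKC <-; elim: (x - y) => [|n IH]; first by rewrite addn0.
  by rewrite addnS Mpath_carrierS; apply: le_trans IH _; rewrite lerDl.
have [y Hy] := H (`|Mpath eta x|.+1)%N.
case: (leqP y x) => [/Hmono|/ltnW/subnKC]; first lia.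
by move=> E; have := Hc (y - x); rewrite E; lia.
Qed.

(** * Bounded soliton sizes and the resulting bounded errors *)

(** This says that seat [I.+1] is never filled, expressed through slot counts so that it can be
    compared with [slots_solitons]. *)
Definition no_seat I eta := forall x, slots I.+1 eta x = slots I eta x.

Lemma loads_leS k eta x : loads k eta x <= loads k.+1 eta x.
Proof.
elim: x => //= x IH; have := cap_leS k eta x; case: (eta _) => /=; lia.
Qed.

Lemma unloads_leS k eta x : unloads k eta x <= unloads k.+1 eta x.
Proof.
elim: x => //= x IH; have := cap_leS k eta x; case: (eta _) => /=; lia.
Qed.

Lemma no_seat_iter I eta t : no_seat I eta -> no_seat I (iter t bbs_step eta).
Proof.
move=> H; elim: t => // t IH x; rewrite [iter _ _ _]/=.
set zeta := iter t bbs_step eta in IH *.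
have := IH x; have := slotsE I zeta x; have := slotsE I.+1 zeta x.
have := slotsE I (bbs_step zeta) x; have := slotsE I.+1 (bbs_step zeta) x.
have := loads_leS I zeta x; have := unloads_leS I zeta x.
have := loads_leS I (bbs_step zeta) x; have := unloads_leS I (bbs_step zeta) x.
have := loadsE I (bbs_step zeta) x; have := loadsE I.+1 (bbs_step zeta) x.
have := cap_leS I (bbs_step zeta) x.
rewrite !loads_bbs_step; lia.
Qed.

Lemma slots_gap k eta x y : x <= y ->
  slots k.+1 eta y + slots k eta x <= slots k.+1 eta x + slots k eta y.
Proof.
move=> /subnKC <-; elim: (y - x) => [|n IH]; first by rewrite addn0.
rewrite addnS !slotsS; have := cap_leS k eta (x + n); have := cap_le k eta (x + n).
by case: (eta _); lia.
Qed.

(** At a record the stack is empty and the solitons alone fix both slot counts; sizes up to [I] do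
    not distinguish capacities [I] and [I.+1]. Monotonicity of the gap carries the equality back to
    every earlier site. *)
Lemma OmegaI_no_seat I eta : OmegaI I eta -> no_seat I eta.
Proof.
move=> [HO HI] x.
have Hinf := Mpath_unbounded_records (Omega_unbounded HO).
have Hle z : slots I.+1 eta z <= slots I eta z.
  by have := @slots_gap I eta 0 z (leq0n _); rewrite /=; lia.
have [y Hxy Hy] := Hinf x.
suff Heq : slots I.+1 eta y = slots I eta y.
  by have := Hle x; have := slots_gap I eta (ltnW Hxy); lia.
have := slots_solitons I.+1 eta y; have := slots_solitons I eta y.
rewrite stack_record //= !addn0.
have -> : \sum_(p <- solitons eta y) 2 * minn p.1 I.+1 =
          \sum_(p <- solitons eta y) 2 * minn p.1 I; last lia.
rewrite !big_seq; apply: eq_bigr => -[j z] Hj /=.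
suff: j <= I by lia.
rewrite leqNgt; apply/negP => Hlt; have := HI j z Hlt; rewrite /sigma /=.
by case: asboolP => // -[]; apply/(has_solitonP _ _ Hinf); exists y.
Qed.

Lemma tot_leS k st : tot k st <= tot k.+1 st.
Proof. by elim: st => //= r st; lia. Qed.

(** Raising the capacity increases each term weakly, and strictly for a size above [I]; equal totals
    force equal terms. *)
Lemma no_seat_sizes I eta x : no_seat I eta ->
  all (fun p => p.1 <= I) (solitons eta x) /\
  all (fun r => size r <= I) (stack eta x).
Proof.
move=> H; have := slots_solitons I eta x; have := slots_solitons I.+1 eta x.
rewrite H; move: (solitons eta x) (stack eta x) => s st H1 H2.
have {H1 H2} : \sum_(p <- s) 2 * minn p.1 I + tot I st =
        \sum_(p <- s) 2 * minn p.1 I.+1 + tot I.+1 st by lia.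
have Hs : forall s' : seq (nat * nat), \sum_(p <- s') 2 * minn p.1 I <=
  \sum_(p <- s') 2 * minn p.1 I.+1.
  by move=> s'; apply: leq_sum => p _; lia.
elim: s => [|p s IH].
  rewrite !big_nil !add0n => E; split => //; elim: st E => //= r st IH E.
  by have := tot_leS I st => Hle; apply/andP; split; [|apply: IH]; lia.
rewrite !big_cons => E; have := Hs s; have := tot_leS I st => H1 H2.
have [|E1 E2] := IH; first lia.
by split => //=; rewrite E1 andbT; lia.
Qed.

(** The run lengths are distinct elements of [1, ..., I]. *)
Lemma size_stack_le I eta x : no_seat I eta -> size (stack eta x) <= I.
Proof.
move=> /(no_seat_sizes x)[_ Hall]; rewrite -(size_map size) -[leqRHS](size_iota 1 I).
apply: uniq_leq_size.
  have := valid_sorted (stack_valid eta x); rewrite map_rev rev_sorted => Hs.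
  by apply: (sorted_uniq ltn_trans ltnn).
move=> l /mapP[r Hr ->]; rewrite mem_iota add1n ltnS (allP Hall _ Hr) andbT.
have := stack_valid eta x; elim: (stack eta x) Hr => //= q st IH; rewrite inE.
move=> /orP[/eqP <-|/IH {}IH]; last by case/and3P => _ /IH.
by case/and3P => /andP[].
Qed.

Lemma tot_le I k eta x : no_seat I eta -> tot k (stack eta x) <= I * I.
Proof.
move=> H; apply: (@leq_trans (size (stack eta x) * I)); last first.
  by rewrite leq_mul2r size_stack_le // orbT.
have [_] := no_seat_sizes x H; elim: (stack eta x) => //= r st IH /andP[Hr /IH].
by rewrite mulSn; lia.
Qed.

Lemma sum_by_size I k (s : seq (nat * nat)) : all (fun p => p.1 <= I) s ->
  \sum_(p <- s) 2 * minn p.1 k =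
  \sum_(1 <= j < I.+1) 2 * minn k j * count (fun p => p.1 == j) s.
Proof.
elim: s => [|p s IH] /=; first by rewrite big_nil big1 // => j _; rewrite muln0.
case/andP => Hp /IH; rewrite big_cons => ->.
under [RHS]eq_bigr do rewrite mulnDr.
rewrite big_split /=; congr (_ + _).
case: (posnP p.1) => [->|Hp0].
  by rewrite min0n muln0 big_nat big1 // => -[|j] //; rewrite muln0.
have Hin : p.1 \in index_iota 1 I.+1 by rewrite mem_index_iota Hp0 ltnS.
rewrite (bigD1_seq p.1 Hin (iota_uniq _ _)) eqxx muln1 minnC big1 /= ?addn0 //.
by move=> j /negbTE; rewrite eq_sym => ->; rewrite muln0.
Qed.

(** As a function of the capacity, [minn p.1 k] has a kink only at [p.1], so its second difference
    at [k.+1] detects size [k.+1]. Carrier contents and the stack contribute bounded errors. *)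
Lemma msol_solitons I k eta x : no_seat I eta ->
  (`|msol k eta x - (count (fun p => p.1 == k.+1) (solitons eta x))%:Z| <= I.+2%:Z)%R.
Proof.
move=> H; have Hst := size_stack_le x H; move: Hst.
have := slots_solitons k eta x; have := slots_solitons k.+1 eta x.
have := slots_solitons k.+2 eta x.
have := slotsE k eta x; have := slotsE k.+1 eta x; have := slotsE k.+2 eta x.
have := loadsE k eta x; have := loadsE k.+1 eta x; have := loadsE k.+2 eta x.
have := cap_leS k eta x; have := cap_leS k.+1 eta x; rewrite /msol.
have: (\sum_(p <- solitons eta x) 2 * minn p.1 k.+1) * 2 =
  \sum_(p <- solitons eta x) 2 * minn p.1 k +
  \sum_(p <- solitons eta x) 2 * minn p.1 k.+2 +
  2 * count (fun p => p.1 == k.+1) (solitons eta x).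
  elim: (solitons eta x) => [|p s IH]; first by rewrite !big_nil.
  rewrite !big_cons [count _ _]/=; move: IH.
  move: (count _ s) (\sum_(j <- s) _) (\sum_(j <- s) _) (\sum_(j <- s) _) => c A B D.
  by case: (eqVneq p.1 k.+1) => [->|Hp] /=; lia.
have: tot k (stack eta x) + tot k.+2 (stack eta x) <= tot k.+1 (stack eta x) * 2
   <= tot k (stack eta x) + tot k.+2 (stack eta x) + size (stack eta x).
  by elim: (stack eta x) => //= r st IH; lia.
lia.
Qed.

Definition nsol (eta : config) (t i x : nat) : nat :=
  \sum_(1 <= y < x.+1) sigma eta i y t.

(** The discrete counterpart of [u - phi_i(u)]: up to a bounded error, the number of sites up to [x]
    that are not [i]-slots. *)
Definition covered (I : nat) (eta : config) (t i x : nat) : nat :=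
  \sum_(1 <= j < I.+1) 2 * minn i j * nsol eta t j x.

Lemma nsol_approx I eta t x : OmegaI I eta ->
  let zeta := iter t bbs_step eta in
  (forall k, (`|msol k zeta x - (nsol eta t k.+1 x)%:Z| <= (I + I).+2%:Z)%R) /\
  (forall k, (`|((slots k zeta x)%:Z + (covered I eta t k x)%:Z - x%:Z)|
              <= (2 * I * I * I + I * I)%:Z)%R).
Proof.
move=> HO zeta.
have Hinf : inf_records zeta.
  apply: Mpath_unbounded_records; apply: Mpath_unbounded_iter.
  by apply: Omega_unbounded; case: HO.
have Hns : no_seat I zeta by apply: no_seat_iter; apply: OmegaI_no_seat.
have Hst := size_stack_le x Hns.
have Hb j := @sigma_sum_bounds eta j x t Hinf; rewrite -/zeta in Hb.
split=> k.
  have := Hb k.+1; have := msol_solitons k x Hns; rewrite -/(nsol eta t k.+1 x); lia.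
have [Hsz _] := no_seat_sizes x Hns.
have := slots_solitons k zeta x; rewrite (sum_by_size k Hsz).
have := tot_le k x Hns.
have H1 : \sum_(1 <= j < I.+1) 2 * minn k j * count (fun p => p.1 == j) (solitons zeta x)
  <= covered I eta t k x.
  by apply: leq_sum => j _; rewrite leq_mul2l; apply/orP; right; case/andP: (Hb j).
(* Each of the [I] sizes has at most [I] uncompleted solitons, with weight at most [2 * I]; the
   remaining [I * I] in the bound comes from [tot]. *)
have H2 : covered I eta t k x <=
  \sum_(1 <= j < I.+1) 2 * minn k j * count (fun p => p.1 == j) (solitons zeta x)
  + 2 * I * I * I.
  apply: (@leq_trans (\sum_(1 <= j < I.+1) (2 * minn k j *
     count (fun p => p.1 == j) (solitons zeta x) + 2 * I * I))).
    rewrite /covered !big_nat; apply: leq_sum => j Hj.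
    apply: (@leq_trans (2 * minn k j * (count (fun p => p.1 == j) (solitons zeta x) + I))).
      rewrite leq_mul2l; apply/orP; right; case/andP: (Hb j) => _ Hj'.
      by apply: leq_trans Hj' _; lia.
    rewrite mulnDr leq_add2l leq_mul2r; apply/orP; right; lia.
  by rewrite big_split /= sum_nat_const_nat subSS subn0; lia.
lia.
Qed.

(* Solitons of size [i] are ordered by the slot in which they sit, and each
   step of the dynamics moves them [i] slots ahead. *)
Lemma nsol_transport I eta t i x x' : OmegaI I eta -> 0 < i ->
  let C := 4 * I * I * I + 2 * I * I + 4 * I + 6 in
  (x + covered I eta 0 i x' + C <= x' + i * t + covered I eta t i x ->
     nsol eta t i x <= nsol eta 0 i x' + C) /\
  (x' + i * t + covered I eta t i x + C <= x + covered I eta 0 i x' ->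
     nsol eta 0 i x' <= nsol eta t i x + C).
Proof.
move=> HO; case: i => // k _ C.
have [H1 H2] := nsol_approx 0 x' HO; have [H3 H4] := nsol_approx t x HO.
have Hu : slots_unbounded k.+1 eta.
  by apply: Mpath_unbounded_slots; apply: Omega_unbounded; case: HO.
move: (H1 k) (H2 k.+1) (H3 k) (H4 k.+1); rewrite /=.
have HT := @msol_transport_le k eta t x x' Hu.
have HG := @msol_transport_ge k eta t x x' Hu.
(* [C] consists of the slot error at both sites, [4 * I * I * I + 2 * I * I], the counting error at
   both sites, [4 * I + 4], and a margin of 2 for strictness and for the error 1 of the
   transport. *)
rewrite /C; split=> H.
  have {}HT := HT ltac:(lia); lia.
have {}HG := HG ltac:(lia); lia.
Qed.

Local Open Scope classical_set_scope.
Local Open Scope ring_scope.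

(** * The continuous profiles *)

Lemma lipschitz_within_continuous (R : realType) (K : R) (f : R -> R) (A : set R) :
  (forall x y : R, `|f x - f y| <= K * `|x - y|) -> {within A, continuous f}.
Proof.
move=> HK; apply: continuous_subspaceT => x.
apply/cvgrPdist_le => e e0; near=> y.
apply: (le_trans (HK x y)).
have HK1 : K <= `|K| + 1 by rewrite (le_trans (ler_norm K)) // lerDl.
have H0 : 0 < `|K| + 1 by rewrite ltr_wpDl.
apply: (@le_trans _ _ ((`|K| + 1) * `|x - y|)); first by rewrite ler_wpM2r.
rewrite -ler_pdivlMl // mulrC; near: y.
by apply: cvgr_dist_le => //; apply: divr_gt0.
Unshelve. all: by end_near. Qed.

Lemma expanding_surj (R : realType) (f : R -> R) (K : R) :
  (forall x y : R, `|f x - f y| <= K * `|x - y|) -> f 0 = 0 ->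
  (forall x y : R, x <= y -> y - x <= f y - f x) ->
  forall u, exists z, f z = u.
Proof.
move=> HK f0 Hexp u; case: (lerP 0 u) => Hu.
  have Hfu := Hexp _ _ Hu; rewrite f0 !subr0 in Hfu.
  have [z _ <-] : exists2 c, c \in `[0, u] & f c = u; last by exists z.
  apply: IVT => //; first exact: lipschitz_within_continuous HK.
  by rewrite f0 ge_min le_max Hu Hfu orbT.
have Hfu := Hexp _ _ (ltW Hu); rewrite f0 !sub0r lerN2 in Hfu.
have [z _ <-] : exists2 c, c \in `[u, 0] & f c = u; last by exists z.
apply: IVT; [exact: ltW | exact: lipschitz_within_continuous HK |].
by rewrite f0 ge_min le_max Hfu (ltW Hu) orbT.
Qed.

(** * The increasing bijections [phi_i] of a profile in [inD] *)

(** Since [minn i j <= minn I j] for [j <= I], every [phi_i] grows at least as fast as [phi_I];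
    strict growth and unboundedness pass from [phi_I] to all of them. *)
Lemma phi_gap (R : realType) I (psi : nat -> R -> R) i u v :
  inCI I psi -> 0 <= u -> u <= v ->
  phi I psi I v - phi I psi I u <= phi I psi i v - phi I psi i u.
Proof.
move=> HC u0 uv; rewrite /phi.
have : \sum_(1 <= j < I.+1) (2 * minn i j)%:R * (psi j v - psi j u) <=
       \sum_(1 <= j < I.+1) (2 * minn I j)%:R * (psi j v - psi j u).
  apply: ler_sum_nat => j Hj; apply: ler_wpM2r.
    by rewrite subr_ge0; have [_ _ _ ->] := HC j Hj.
  by rewrite ler_nat; lia.
under eq_bigr do rewrite mulrBr.
under [X in _ <= X]eq_bigr do rewrite mulrBr.
by rewrite !sumrB; lra.
Qed.

Lemma phi0 (R : realType) I (psi : nat -> R -> R) i : inCI I psi -> phi I psi i 0 = 0.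
Proof.
move=> HC; rewrite /phi big_nat big1 ?subr0 // => j Hj.
by have [-> _ _ _] := HC j Hj; rewrite mulr0.
Qed.

Lemma phi_gap_le (R : realType) I (psi : nat -> R -> R) i u v :
  inCI I psi -> 0 <= u -> u <= v -> phi I psi i v - phi I psi i u <= v - u.
Proof.
move=> HC u0 uv; rewrite /phi.
have : 0 <= \sum_(1 <= j < I.+1) (2 * minn i j)%:R * (psi j v - psi j u).
  rewrite big_nat; apply: sumr_ge0 => j Hj; apply: mulr_ge0 => //.
  by rewrite subr_ge0; have [_ _ _ ->] := HC j Hj.
by under eq_bigr do rewrite mulrBr; rewrite sumrB; lra.
Qed.

Lemma phi_lt (R : realType) I (psi : nat -> R -> R) i u v :
  inD I psi -> 0 <= u -> u < v -> phi I psi i u < phi I psi i v.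
Proof.
move=> [HC [_ Hs _] _] u0 uv; have := phi_gap i HC u0 (ltW uv).
by have := Hs _ _ u0 uv; lra.
Qed.

Lemma phi_le (R : realType) I (psi : nat -> R -> R) i u v :
  inD I psi -> 0 <= u -> u <= v -> phi I psi i u <= phi I psi i v.
Proof.
move=> HD u0; rewrite le_eqVlt => /orP[/eqP -> //|uv].
exact/ltW/phi_lt.
Qed.

Lemma phi_ge0 (R : realType) I (psi : nat -> R -> R) i u :
  inD I psi -> 0 <= u -> 0 <= phi I psi i u.
Proof.
move=> HD u0; have [HC _ _] := HD; rewrite -(phi0 i HC); exact: phi_le.
Qed.

Lemma phi_inj (R : realType) I (psi : nat -> R -> R) i u v :
  inD I psi -> 0 <= u -> 0 <= v -> phi I psi i u = phi I psi i v -> u = v.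
Proof.
move=> HD u0 v0 E; case: (ltgtP u v) => //.
  by move=> /(phi_lt i HD u0); rewrite E ltxx.
by move=> /(phi_lt i HD v0); rewrite E ltxx.
Qed.

Lemma phi_unbounded (R : realType) I (psi : nat -> R -> R) (z : R) :
  inD I psi -> exists2 u : R, 0 <= u & forall i, z <= phi I psi i u.
Proof.
move=> HD; have [HC [_ _ Hinf] _] := HD.
move/cvgryPge: Hinf => /(_ z) [M [_ HM]].
have H0 : 0 <= `|M| + 1 by rewrite addr_ge0.
have HMx : z <= phi I psi I (`|M| + 1) by apply: HM; have := ler_norm M; lra.
exists (`|M| + 1) => // i.
have := phi_gap i HC (lexx 0) H0; rewrite !phi0 //; lra.
Qed.

Lemma phi_surj (R : realType) I (psi : nat -> R -> R) i z :
  inD I psi -> 0 <= z -> exists u : R, 0 <= u /\ phi I psi i u = z.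
Proof.
move=> HD z0; have [HC _ _] := HD.
have [u1 u10 /(_ i) Hz] := phi_unbounded z HD.
(* Extension by a constant to the negative half-line, which gives a 1-Lipschitz function on the
   whole line. *)
pose f (x : R) := phi I psi i (Num.max x 0).
have Hm (x : R) : 0 <= Num.max x 0 by rewrite le_max lexx orbT.
have Hf (x y : R) : x <= y -> `|f x - f y| <= 1 * `|x - y|.
  move=> xy; have Hxy : Num.max x 0 <= Num.max y 0.
    by rewrite ge_max !le_max xy lexx orbT.
  have := phi_gap_le i HC (Hm x) Hxy; have := phi_le i HD (Hm x) Hxy.
  rewrite -/(f x) -/(f y) => H1 H2; rewrite mul1r !ler0_norm; [|lra|lra].
  have : Num.max y 0 - Num.max x 0 <= y - x.
    by case: (lerP y 0) => ?; case: (lerP x 0) => ?; lra.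
  lra.
have {}Hf (x y : R) : `|f x - f y| <= 1 * `|x - y|.
  have [H|/ltW H] := leP x y; first exact: Hf.
  by rewrite distrC [`|x - y|]distrC; exact: Hf.
have [u] : exists2 c, c \in `[0, u1] & f c = z.
  apply: IVT => //; first exact: lipschitz_within_continuous Hf.
  by rewrite ge_min le_max /f maxxx phi0 // z0 (max_idPl u10) Hz orbT.
rewrite in_itv /= => /andP[u0 _] <-; exists u; split => //.
by rewrite /f (max_idPl u0).
Qed.

Lemma inv_phiP (R : realType) I (psi : nat -> R -> R) i z :
  inD I psi -> 0 <= z ->
  0 <= inv_pos (phi I psi i) z /\ phi I psi i (inv_pos (phi I psi i) z) = z.
Proof.
move=> HD z0; rewrite /inv_pos; case: pselect => [h|[]]; first by case: cid.
exact: phi_surj.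
Qed.

Lemma phiK (R : realType) I (psi : nat -> R -> R) i u :
  inD I psi -> 0 <= u -> inv_pos (phi I psi i) (phi I psi i u) = u.
Proof.
move=> HD u0; have [H1 H2] := inv_phiP i HD (phi_ge0 i HD u0).
exact: phi_inj HD H1 u0 H2.
Qed.

Lemma ratio_sup_ge0 (R : realType) I (psi : nat -> R -> R) i :
  inD I psi -> (1 <= i <= I)%N -> (0 <= ratio_sup I psi i)%E.
Proof.
move=> HD Hi; have [HC _ _] := HD.
apply: (@le_trans _ _ ((psi i 1 - psi i 0) / (phi I psi i 1 - phi I psi i 0))%:E).
  rewrite lee_fin; apply: divr_ge0; rewrite subr_ge0; last exact: phi_le.
  by have [_ _ _ ->] := HC i Hi.
by apply: ereal_sup_ubound; exists 1, 0; split => //; rewrite oner_eq0.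
Qed.

(** The constants are the suprema themselves. A single infinite one would make the sum infinite,
    because all terms are nonnegative and the weights are at least 1. *)
Lemma lipschitz_constants (R : realType) I (psi : nat -> R -> R) : inD I psi ->
  exists L : nat -> R, [/\ forall i, 0 <= L i,
    \sum_(1 <= i < I.+1) i%:R * L i < 2^-1 &
    forall i (u v : R), (1 <= i <= I)%N -> 0 <= u -> 0 <= v ->
      `|psi i u - psi i v| <= L i * `|phi I psi i u - phi I psi i v|].
Proof.
move=> HD; have [HC _ Hsum] := HD.
have Hge i : (1 <= i <= I)%N -> (0 <= i%:R%:E * ratio_sup I psi i)%E.
  by move=> Hi; apply: mule_ge0; [rewrite lee_fin | exact: ratio_sup_ge0].
have Hfin i : (1 <= i <= I)%N -> ratio_sup I psi i \is a fin_num.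
  move=> Hi; have H0 := ratio_sup_ge0 HD Hi.
  rewrite ge0_fin_numE // ltNge leye_eq; apply/negP => /eqP Hoo.
  suff : (\sum_(1 <= j < I.+1) j%:R%:E * ratio_sup I psi j = +oo)%E.
    by move=> E; rewrite E in Hsum.
  rewrite (bigD1_seq i) ?mem_index_iota ?iota_uniq //= Hoo gt0_muley; last by rewrite lte_fin ltr0n; lia.
  rewrite addye // -ltNye; apply: lt_le_trans (ltNyr 0) _.
  rewrite big_seq_cond; apply: sume_ge0 => j /andP[].
  by rewrite mem_index_iota ltnS => Hj _; apply: Hge.
exists (fun i => if (1 <= i <= I)%N then fine (ratio_sup I psi i) else 0); split.
- move=> i; case: ifP => // Hi; apply: fine_ge0; exact: ratio_sup_ge0.
- rewrite -lte_fin; apply: le_lt_trans Hsum.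
  rewrite -sumEFin big_nat [leRHS]big_nat; apply: lee_sum => i Hi.
  by rewrite ltnS in Hi; rewrite EFinM Hi fineK // Hfin.
move=> i u v Hi; rewrite Hi => u0 v0.
case: (eqVneq u v) => [->|uv]; first by rewrite !subrr normr0 mulr0.
have Hne : 0 < `|phi I psi i u - phi I psi i v|.
  by rewrite normr_gt0 subr_eq0; apply: contra_neq uv; exact: phi_inj.
rewrite -ler_pdivrMr // -normf_div.
have Hr : 0 <= (psi i u - psi i v) / (phi I psi i u - phi I psi i v).
  wlog uv' : u v u0 v0 uv Hne / u <= v.
    move=> Hw; have [H|/ltW H] := leP u v; first exact: Hw.
    rewrite -(opprB (psi i v)) -(opprB (phi I psi i v)) invrN mulrNN.
    by apply: Hw => //; [rewrite eq_sym | rewrite distrC].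
  rewrite -(opprB (psi i v)) -(opprB (phi I psi i v)) invrN mulrNN.
  apply: divr_ge0; rewrite subr_ge0.
    by have [_ _ _ ->] := HC i Hi.
  exact: phi_le.
rewrite ger0_norm // -lee_fin fineK ?Hfin //.
by apply: ereal_sup_ubound; exists u, v.
Qed.

(* The equations [psi_i = chi_i (phi_i)] are triangular in [phi_I, phi_(I-1), ..., phi_0 = u]. *)
Lemma triangular_system (R : realType) I (chi : nat -> R -> R) :
  exists f : nat -> R -> R, (forall z, f I z = z) /\
    forall i z, (i < I)%N ->
      f i z = f i.+1 z + 2 * \sum_(i.+1 <= j < I.+1) chi j (f j z).
Proof.
suff H : forall n, (n <= I)%N -> exists f : nat -> R -> R, (forall z, f I z = z) /\
    forall i z, (I - n <= i < I)%N ->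
      f i z = f i.+1 z + 2 * \sum_(i.+1 <= j < I.+1) chi j (f j z).
  by have [f [H1 H2]] := H I (leqnn I); exists f; split => // i z Hi; apply: H2; lia.
elim=> [|n IH] Hn; first by exists (fun _ z => z); split => // i z; lia.
have [|f [H1 H2]] := IH; first lia.
exists (fun i z => if i == (I - n.+1)%N then
  f i.+1 z + 2 * \sum_(i.+1 <= j < I.+1) chi j (f j z) else f i z); split.
  by move=> z; rewrite ifN //; lia.
move=> i z Hi; rewrite [X in _ = X + _]ifN; last lia.
have E : \sum_(i.+1 <= j < I.+1) chi j (if j == (I - n.+1)%N then
    f j.+1 z + 2 * \sum_(j.+1 <= k < I.+1) chi k (f k z) else f j z) =
  \sum_(i.+1 <= j < I.+1) chi j (f j z).
  by apply: eq_big_nat => j Hj; rewrite ifN //; lia.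
rewrite E; case: eqP => // Hne; apply: H2; lia.
Qed.

Lemma triangular_down I (P : nat -> Prop) : P I ->
  (forall i, (i < I)%N -> (forall j, (i < j <= I)%N -> P j) -> P i) ->
  forall i, (i <= I)%N -> P i.
Proof.
move=> HI Hs i Hi; rewrite -(subKn Hi).
elim/ltn_ind: (I - i)%N (leq_subr i I) => n IH Hn.
case: (posnP n) => [->|Hn0]; first by rewrite subn0.
apply: Hs; first lia.
move=> j Hj; have := IH (I - j)%N; rewrite subKn; last lia.
apply; lia.
Qed.

(** With [z = phi_I] as parameter all [phi_i] are explicit functions [f i z], and [u = f 0 z] grows
    at least at unit speed, hence is invertible. The bound on the Lipschitz constants gives the last
    condition of [inD]. *)
Lemma exists_fixed_profile (R : realType) I (chi : nat -> R -> R) (L : nat -> R) :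
  (forall i, 0 <= L i) -> \sum_(1 <= i < I.+1) i%:R * L i < 2^-1 ->
  (forall i (x y : R), (1 <= i <= I)%N -> `|chi i x - chi i y| <= L i * `|x - y|) ->
  (forall i (x y : R), (1 <= i <= I)%N -> x <= y -> chi i x <= chi i y) ->
  (forall i, (1 <= i <= I)%N -> chi i 0 = 0) ->
  exists psi : nat -> R -> R, inD I psi /\
    forall i u, (1 <= i <= I)%N -> psi i u = chi i (phi I psi i u).
Proof.
move=> L0 Lsum Llip Lmono Lzero.
have [f [fI fS]] := triangular_system I chi.
have f0 : forall i, (i <= I)%N -> f i 0 = 0.
  apply: triangular_down => // i Hi IH; rewrite fS // IH; last lia.
  rewrite add0r big_nat big1 ?mulr0 // => j Hj.
  by rewrite IH; [apply: Lzero|]; lia.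
have fmono : forall i, (i <= I)%N -> forall x y, x <= y -> y - x <= f i y - f i x.
  apply: triangular_down => [x y|i Hi IH x y xy]; first by rewrite !fI.
  rewrite (fS i x) // (fS i y) //; have := IH i.+1 ltac:(lia) _ _ xy.
  have : \sum_(i.+1 <= j < I.+1) chi j (f j x) <= \sum_(i.+1 <= j < I.+1) chi j (f j y).
    apply: ler_sum_nat => j Hj; apply: Lmono; first lia.
    by have := IH j ltac:(lia) _ _ xy; lra.
  lra.
have flip : forall i, (i <= I)%N -> exists2 K, 0 <= K &
    forall x y, `|f i x - f i y| <= K * `|x - y|.
  apply: triangular_down => [|i Hi IH].
    by exists 1 => // x y; rewrite !fI mul1r.
  (* A choice of Lipschitz constants for the functions already treated; the default 0 is taken where
     none exists. *)
  pose K j := if pselect (exists2 K, 0 <= K & forall x y, `|f j x - f j y| <= K * `|x - y|)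
    is left h then projT1 (cid2 h) else 0.
  have HK j : (i < j <= I)%N -> 0 <= K j /\ forall x y, `|f j x - f j y| <= K j * `|x - y|.
    move=> Hj; rewrite /K; case: pselect => [h|[]]; last exact: IH.
    by case: cid2.
  have [K0 HKi] := HK i.+1 ltac:(lia).
  exists (K i.+1 + 2 * \sum_(i.+1 <= j < I.+1) L j * K j).
    apply: addr_ge0 => //; apply: mulr_ge0 => //; rewrite big_nat.
    by apply: sumr_ge0 => j Hj; apply: mulr_ge0 => //; have [] := HK j ltac:(lia).
  move=> x y; rewrite (fS i x) // (fS i y) // opprD addrACA -mulrBr -sumrB.
  rewrite [leRHS]mulrDl -(mulrA 2).
  apply: le_trans (ler_normD _ _) _; apply: lerD => //.
  rewrite normrM ger0_norm // ler_wpM2l // mulr_suml.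
  apply: le_trans (ler_norm_sum _ _ _) _.
  apply: ler_sum_nat => j Hj; apply: (le_trans (Llip j _ _ ltac:(lia))).
  by rewrite -mulrA ler_wpM2l //; have [_] := HK j ltac:(lia).
have [K K0 HK] := flip 0%N (leq0n _).
have Hz (u : R) : {z | f 0%N z = u}.
  apply: cid; exact: (expanding_surj HK (f0 0%N (leq0n _)) (fmono 0%N (leq0n _))).
pose z u := projT1 (Hz u).
have Ez u : f 0%N (z u) = u by rewrite /z; case: (Hz u).
have zmono (u v : R) : u <= v -> z u <= z v <= z u + (v - u).
  move=> uv; have Huv : z u <= z v.
    rewrite leNgt; apply/negP => H.
    by have := fmono 0%N (leq0n _) _ _ (ltW H); rewrite !Ez; lra.
  by rewrite Huv /=; have := fmono 0%N (leq0n _) _ _ Huv; rewrite !Ez; lra.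
have zlip (u v : R) : `|z u - z v| <= 1 * `|u - v|.
  have H (a b : R) : a <= b -> `|z a - z b| <= 1 * `|a - b|.
    by move=> ab; have /andP[H1 H2] := zmono _ _ ab; rewrite mul1r !ler0_norm; lra.
  have [/H //|/ltW/H] := leP u v.
  by rewrite distrC [`|v - u|]distrC.
have z0 : z 0 = 0.
  have H := fmono 0%N (leq0n _).
  have [E|/ltW E] := leP (z 0) 0; have := H _ _ E; rewrite Ez f0 //; lra.
pose psi i u := chi i (f i (z u)).
(* Induction upwards from [phi_0 u = u = f 0 (z u)]: [minn i.+1 j] exceeds [minn i j] by one exactly
   when [j > i]. *)
have Ephi i u : (i <= I)%N -> phi I psi i u = f i (z u).
  rewrite /phi; elim: i => [|i IH] Hi.
    by rewrite big1 ?subr0 // => j _; rewrite min0n muln0 mul0r.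
  have := IH (ltnW Hi); rewrite (fS i) // => H.
  suff : \sum_(1 <= j < I.+1) (2 * minn i.+1 j)%:R * psi j u =
    \sum_(1 <= j < I.+1) (2 * minn i j)%:R * psi j u +
    2 * \sum_(i.+1 <= j < I.+1) chi j (f j (z u)) by lra.
  rewrite (@big_cat_nat _ _ _ i.+1 1 I.+1) //=; last lia.
  rewrite [X in _ = X + _](@big_cat_nat _ _ _ i.+1 1 I.+1) //=; last lia.
  rewrite -addrA mulr_sumr -big_split /=; congr (_ + _).
    by apply: eq_big_nat => j Hj; congr (_%:R * _); lia.
  apply: eq_big_nat => j Hj; rewrite -mulrDl -natrD; congr (_%:R * _); lia.
exists psi; split; last by move=> i u Hi; rewrite Ephi //; lia.
have Hpsi i : (1 <= i <= I)%N -> inC (psi i).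
  move=> Hi; have HiI : (i <= I)%N by lia.
  have Hnd (u v : R) : u <= v -> psi i u <= psi i v.
    move=> /zmono/andP[uv _]; apply: Lmono => //.
    by have := fmono i HiI _ _ uv; lra.
  have psi_0 : psi i 0 = 0 by rewrite /psi z0 f0 // Lzero.
  split => //; first by move=> u u0; rewrite -psi_0; exact: Hnd.
    have [Ki Ki0 HKi] := flip i HiI.
    apply: (@lipschitz_within_continuous R (L i * Ki)) => x y.
    apply: (le_trans (Llip i _ _ Hi)); rewrite -mulrA ler_wpM2l //.
    by apply: (le_trans (HKi _ _)); rewrite ler_wpM2l // -[leRHS]mul1r zlip.
  by move=> u v _; exact: Hnd.
have EI : phi I psi I = z by apply/funext => u; rewrite Ephi // fI.
have zlt (u v : R) : u < v -> z u < z v.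
  move=> uv; have /andP[+ _] := zmono _ _ (ltW uv).
  rewrite le_eqVlt => /orP[/eqP E|//].
  by move: uv; rewrite -(Ez u) E Ez ltxx.
split => //.
  rewrite EI; split; first split => //.
  - by move=> u u0; rewrite -z0; have /andP[] := zmono _ _ u0.
  - exact: lipschitz_within_continuous zlip.
  - by move=> u v _ /zmono /andP[].
  - by move=> u v _; exact: zlt.
  apply/cvgryPge => A; exists (f 0%N A); split; first exact: num_real.
  move=> u /= Hu; rewrite leNgt; apply/negP => HA.
  by have := fmono 0%N (leq0n _) _ _ (ltW HA); rewrite Ez; lra.
apply: (@le_lt_trans _ _ (\sum_(1 <= i < I.+1) i%:R * L i)%:E); last first.
  by rewrite lte_fin.
rewrite -sumEFin big_nat [leRHS]big_nat; apply: lee_sum => i Hi.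
rewrite ltnS in Hi; rewrite EFinM lee_wpmul2l ?lee_fin //.
(* The slopes of [psi_i] against [phi_i] are slopes of [chi i], hence at most [L i]. *)
apply: ge_ereal_sup => _ [u1 [u2 [_ _ _ ->]]]; rewrite lee_fin.
rewrite !Ephi; [|lia|lia].
set a := f i _; set b := f i _.
have H := Llip i a b Hi.
case: (eqVneq a b) => [->|ab]; first by rewrite subrr invr0 mulr0.
apply: le_trans (ler_norm _) _; rewrite normf_div ler_pdivrMr //.
by rewrite normr_gt0 subr_eq0.
Qed.

(** * The transform [Upsilon], its inverse, and stability of the fixed-point system *)

Lemma inv_phi_le (R : realType) I (psi : nat -> R -> R) i (z1 z2 : R) :
  inD I psi -> 0 <= z1 -> z1 <= z2 ->
  inv_pos (phi I psi i) z1 <= inv_pos (phi I psi i) z2.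
Proof.
move=> HD z0 z12; have [H1 E1] := inv_phiP i HD z0.
have [H2 E2] := inv_phiP i HD (le_trans z0 z12).
rewrite leNgt; apply/negP => /(phi_lt i HD H2).
by rewrite E1 E2 ltNge z12.
Qed.

Lemma Upsilon_le (R : realType) I (psi : nat -> R -> R) i (z1 z2 : R) :
  inD I psi -> (1 <= i <= I)%N -> 0 <= z1 -> z1 <= z2 ->
  Upsilon I psi i z1 <= Upsilon I psi i z2.
Proof.
move=> HD Hi z0 z12; have [HC _ _] := HD; have [_ _ _ Hm] := HC i Hi.
apply: Hm; last exact: inv_phi_le.
by have [] := inv_phiP i HD z0.
Qed.

Lemma Upsilon0 (R : realType) I (psi : nat -> R -> R) i :
  inD I psi -> (1 <= i <= I)%N -> Upsilon I psi i 0 = 0.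
Proof.
move=> HD Hi; have [HC _ _] := HD; have [H0 _ _ _] := HC i Hi.
by have := phiK i HD (lexx 0); rewrite /Upsilon phi0 // => ->.
Qed.

Lemma Upsilon_lipschitz (R : realType) I (psi : nat -> R -> R) i (K z1 z2 : R) :
  inD I psi -> (forall u v : R, 0 <= u -> 0 <= v ->
      `|psi i u - psi i v| <= K * `|phi I psi i u - phi I psi i v|) ->
  0 <= z1 -> 0 <= z2 -> `|Upsilon I psi i z1 - Upsilon I psi i z2| <= K * `|z1 - z2|.
Proof.
move=> HD HK z10 z20; have [H1 E1] := inv_phiP i HD z10.
have [H2 E2] := inv_phiP i HD z20.
by have := HK _ _ H1 H2; rewrite E1 E2.
Qed.

Lemma max0_lip (R : realType) (x y : R) : `|Num.max x 0 - Num.max y 0| <= `|x - y|.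
Proof.
wlog xy : x y / x <= y.
  move=> H; have [/H //|/ltW/H] := leP x y.
  by rewrite distrC [`|y - x|]distrC.
have [x0|x0] := leP x 0; have [y0|y0] := leP y 0; rewrite !ler0_norm; lra.
Qed.

(** Evaluating the defining property of the chosen preimage at [phi_i(u)] gives the equation;
    [exists_fixed_profile] rules out the default branch. *)
Lemma Upsilon_inv_eq (R : realType) I (psi : nat -> R -> R) (t : R) :
  inD I psi -> 0 <= t ->
  let chi := theta t (Upsilon I psi) in
  let Psi := Upsilon_inv I chi in
  forall i u, (1 <= i <= I)%N -> 0 <= u -> Psi i u = chi i (phi I Psi i u).
Proof.
move=> HD t0 chi Psi i u Hi u0; rewrite /Psi /Upsilon_inv.
case: pselect => [h|[]].
  case: cid => Q [HQ HU] /=.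
  have := HU i _ Hi (phi_ge0 i HQ u0).
  by rewrite {1}/Upsilon phiK.
have [L [L0 Lsum Llip]] := lipschitz_constants HD.
have Hm (x : R) : 0 <= Num.max x 0 by rewrite le_max lexx orbT.
have [|||Q [HQ HE]] := @exists_fixed_profile R I chi L L0 Lsum.
- move=> j x y Hj; rewrite /chi /theta.
  apply: le_trans (Upsilon_lipschitz HD _ _ _) _ => //.
    by move=> a b; exact: Llip.
  rewrite ler_wpM2l //; apply: le_trans (max0_lip _ _) _.
  by rewrite (_ : x - j%:R * t - (y - j%:R * t) = x - y) //; ring.
- move=> j x y Hj xy; rewrite /chi /theta; apply: Upsilon_le => //.
  by rewrite ge_max !le_max lexx orbT andbT lerB.
- move=> j Hj; rewrite /chi /theta sub0r (max_idPr _) ?Upsilon0 //.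
  by rewrite oppr_le0 mulr_ge0.
exists Q; split => // j z Hj z0; rewrite {1}/Upsilon HE //.
by have [_ ->] := inv_phiP j HQ z0.
Qed.

(** The estimate is pointwise in [u]. With [D] the weighted distance, [minn i j <= j] gives [2 * D]
    as a bound for the change of each [phi_i], so [D] is at most [2 * S * D] plus the error term. *)
Lemma phi_stability (R : realType) I (L : nat -> R) (e : R) (a b : nat -> R -> R) (u : R) :
  (forall i, 0 <= L i) ->
  (forall i, (1 <= i <= I)%N ->
     `|a i u - b i u| <= L i * `|phi I a i u - phi I b i u| + e) ->
  0 <= e -> forall i, (1 <= i <= I)%N ->
  `|a i u - b i u| * (1 - 2 * \sum_(1 <= j < I.+1) j%:R * L j) <= (I * I)%:R * e.
Proof.
move=> L0 H e0; set S := \sum_(1 <= j < I.+1) j%:R * L j.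
pose D := \sum_(1 <= j < I.+1) j%:R * `|a j u - b j u|.
have Hphi i : (1 <= i <= I)%N -> `|phi I a i u - phi I b i u| <= 2 * D.
  move=> Hi; rewrite /phi.
  have -> : u - \sum_(1 <= j < I.+1) (2 * minn i j)%:R * a j u -
    (u - \sum_(1 <= j < I.+1) (2 * minn i j)%:R * b j u) =
    \sum_(1 <= j < I.+1) (2 * minn i j)%:R * (b j u - a j u).
    by under [RHS]eq_bigr do rewrite mulrBr; rewrite sumrB; ring.
  apply: le_trans (ler_norm_sum _ _ _) _; rewrite /D mulr_sumr.
  apply: ler_sum_nat => j Hj; rewrite normrM ger0_norm // distrC mulrA -natrM.
  by rewrite ler_wpM2r // ler_nat; lia.
have HD : D <= 2 * S * D + (I * I)%:R * e.
  rewrite {1}/D (_ : 2 * S * D = \sum_(1 <= j < I.+1) j%:R * (L j * (2 * D))); last first.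
    rewrite (_ : 2 * S * D = S * (2 * D)); last ring.
    by rewrite mulr_suml; apply: eq_bigr => j _; rewrite mulrA.
  have -> : (I * I)%:R * e = \sum_(1 <= j < I.+1) I%:R * e.
    by rewrite sumr_const_nat subn1 /= -[RHS]mulr_natl natrM mulrA.
  rewrite -big_split /=; apply: ler_sum_nat => j Hj.
  apply: (@le_trans _ _ (j%:R * (L j * `|phi I a j u - phi I b j u| + e))).
    by rewrite ler_wpM2l //; apply: H; lia.
  rewrite mulrDr; apply: lerD; last by rewrite ler_wpM2r // ler_nat; lia.
  by do 2 apply: ler_wpM2l => //; apply: Hphi; lia.
move=> i Hi; have Hle : `|a i u - b i u| <= D.
  rewrite /D (bigD1_seq i) ?mem_index_iota ?iota_uniq //=.
  apply: (@le_trans _ _ (i%:R * `|a i u - b i u|)).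
    by rewrite -[leLHS]mul1r ler_wpM2r // ler1n; lia.
  by rewrite lerDl; apply: sumr_ge0 => j _; apply: mulr_ge0.
have D0 : 0 <= D by apply: sumr_ge0 => j _; apply: mulr_ge0.
(* If the factor is negative, the left-hand side is nonpositive and the claim holds at once. *)
have [Hs|/ltW Hs] := leP 0 (1 - 2 * S).
  apply: (@le_trans _ _ (D * (1 - 2 * S))); first by rewrite ler_wpM2r.
  lra.
apply: (@le_trans _ _ 0); last by rewrite mulr_ge0.
by rewrite mulr_ge0_le0.
Qed.

(** * Rescaled soliton counts as approximate fixed profiles *)

Lemma psiN_nsol (R : realType) N eta i (u t : R) :
  psiN N eta i u t =
  N%:R^-1 * (nsol eta (Num.truncn (N%:R * t)) i (Num.truncn (N%:R * u)))%:R.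
Proof. by rewrite /psiN /nsol natr_sum. Qed.

Lemma phi_psiN (R : realType) I N eta i (u t : R) :
  phi I (fun j v => psiN N eta j v t) i u =
  u - N%:R^-1 * (covered I eta (Num.truncn (N%:R * t)) i (Num.truncn (N%:R * u)))%:R.
Proof.
rewrite /phi /covered natr_sum mulr_sumr; congr (_ - _).
by apply: eq_bigr => j _; rewrite psiN_nsol natrM; ring.
Qed.

Lemma psiN_transport (R : realType) I : exists2 C : R, 0 <= C &
  forall N eta i (u v t : R), (0 < N)%N -> OmegaI I eta -> (1 <= i <= I)%N ->
    0 <= u -> 0 <= v -> 0 <= t ->
    let a := fun j x => psiN N eta j x 0 in
    let b := fun j x => psiN N eta j x t in
    (phi I b i u + C / N%:R <= phi I a i v + i%:R * t ->
       b i u <= a i v + C / N%:R) /\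
    (phi I a i v + i%:R * t + C / N%:R <= phi I b i u ->
       a i v <= b i u + C / N%:R).
Proof.
pose C0 := (4 * I * I * I + 2 * I * I + 4 * I + 6)%N.
(* The summand 1 absorbs the rounding of a site and [I] that of the time, which is multiplied by
   [i <= I]. *)
exists (C0 + 1 + I)%:R => // N eta i u v t N0 HO Hi u0 v0 t0 a b.
have n0 : 0 < N%:R :> R by rewrite ltr0n.
have nn : N%:R != 0 :> R by rewrite gt_eqF.
rewrite /a /b !phi_psiN !psiN_nsol mulr0 truncn0.
set x := Num.truncn (N%:R * u); set x' := Num.truncn (N%:R * v).
set k := Num.truncn (N%:R * t).
have /andP[Hx1 Hx2] := truncn_itv (mulr_ge0 (ltW n0) u0); rewrite -/x in Hx1 Hx2.
have /andP[Hy1 Hy2] := truncn_itv (mulr_ge0 (ltW n0) v0); rewrite -/x' in Hy1 Hy2.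
have /andP[Hk1 Hk2] := truncn_itv (mulr_ge0 (ltW n0) t0); rewrite -/k in Hk1 Hk2.
have /andP[i0 iI] := Hi.
have [HT1 HT2] := @nsol_transport I eta k i x x' HO i0.
rewrite -/C0 in HT1 HT2; clearbody C0.
set c := covered I eta k i x in HT1 HT2 *; set c' := covered I eta 0 i x' in HT1 HT2 *.
set s := nsol eta k i x in HT1 HT2 *; set s' := nsol eta 0 i x' in HT1 HT2 *.
have HiI : i%:R <= I%:R :> R by rewrite ler_nat.
have Hik1 : i%:R * k%:R <= N%:R * (i%:R * t).
  by rewrite mulrCA ler_wpM2l.
have Hik2 : N%:R * (i%:R * t) <= i%:R * k%:R + i%:R.
  rewrite mulrCA -[X in _ + X]mulr1 -mulrDr natr1.
  by rewrite ler_wpM2l // ltW.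
have pm (A B : R) : (A <= B) = (N%:R * A <= N%:R * B) by rewrite ler_pM2l.
have E1 (A : R) : N%:R * (N%:R^-1 * A) = A by rewrite mulVKf.
have E2 (A : R) : N%:R * (A / N%:R) = A by rewrite mulrC mulfVK.
have I0 : 0 <= I%:R :> R by [].
rewrite -!natr1 in Hx2 Hy2.
split=> H; rewrite pm !mulrDr ?mulrN !E1 !E2 in H;
    rewrite pm !mulrDr !E1 E2; rewrite !natrD in H *.
  have : (s <= s' + C0)%N.
    apply: HT1; rewrite -(ler_nat R) !natrD natrM; lra.
  by rewrite -(ler_nat R) natrD; lra.
have : (s' <= s + C0)%N.
  apply: HT2; rewrite -(ler_nat R) !natrD natrM; lra.
by rewrite -(ler_nat R) natrD; lra.
Qed.

Lemma phi_close (R : realType) I (a b : nat -> R -> R) (v d : R) i :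
  (forall j, (1 <= j <= I)%N -> `|a j v - b j v| <= d) -> 0 <= d ->
  `|phi I a i v - phi I b i v| <= (2 * I * I)%:R * d.
Proof.
move=> H d0; rewrite /phi.
have -> : v - \sum_(1 <= j < I.+1) (2 * minn i j)%:R * a j v -
    (v - \sum_(1 <= j < I.+1) (2 * minn i j)%:R * b j v) =
    \sum_(1 <= j < I.+1) (2 * minn i j)%:R * (b j v - a j v).
  by under [RHS]eq_bigr do rewrite mulrBr; rewrite sumrB; ring.
apply: le_trans (ler_norm_sum _ _ _) _.
have -> : (2 * I * I)%:R * d = \sum_(1 <= j < I.+1) (2 * I)%:R * d.
  by rewrite sumr_const_nat subn1 /= -[RHS]mulr_natl !natrM; ring.
apply: ler_sum_nat => j Hj; rewrite normrM ger0_norm // distrC.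
by apply: ler_pM => //; [rewrite ler_nat; lia | apply: H; lia].
Qed.

(** Transport compares only positions whose slot numbers are separated by a margin. Moving the
    comparison point by [r] to either side creates the margin, at the cost of another [r] because
    [Upsilon] is 1-Lipschitz. *)
Lemma discrete_fixed_profile (R : realType) I (psi0 : nat -> R -> R) (t u0 : R) :
  inD I psi0 -> 0 <= t -> 0 <= u0 ->
  exists C u1 : R, [/\ 0 <= C, 0 < u1 &
    forall N eta (d : R), (0 < N)%N -> OmegaI I eta -> 0 <= d ->
    (forall j v, (1 <= j <= I)%N -> 0 <= v <= u1 ->
       `|psiN N eta j v 0 - psi0 j v| <= d) ->
    let r := C / N%:R + C * d in r <= 1 ->
    let b := fun j x => psiN N eta j x t in
    forall i u, (1 <= i <= I)%N -> 0 <= u <= u0 ->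
      `|b i u - theta t (Upsilon I psi0) i (phi I b i u)| <= 2 * r].
Proof.
move=> HD t0 u00.
have [L [L0 Lsum Llip]] := lipschitz_constants HD.
have L1 i : (1 <= i <= I)%N -> L i <= 1.
  move=> Hi; have : i%:R * L i <= 2^-1.
    apply: le_trans (ltW Lsum).
    rewrite (bigD1_seq i) ?mem_index_iota ?iota_uniq //= lerDl.
    by apply: sumr_ge0 => j _; apply: mulr_ge0.
  have : L i <= i%:R * L i.
    by rewrite -[leLHS]mul1r ler_wpM2r // ler1n; lia.
  lra.
have [C0 C00 HC0] := psiN_transport R I.
(* Comparison points [z] stay below [u0 + r <= u0 + 1], so their preimages under all [phi_i] lie in
   [[0, u1]]. *)
have [u1 u10 Hu1] := phi_unbounded (u0 + 1) HD.
exists (C0 + (2 * I * I)%:R + 1), (u1 + 1); split; first by rewrite !addr_ge0.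
  by rewrite ltr_wpDl.
move=> N eta d N0 HO d0 Hd r r1 b i u Hi /andP[ux uy].
have n0 : 0 < N%:R :> R by rewrite ltr0n.
have HC0' : C0 / N%:R + (2 * I * I)%:R * d + d <= r.
  rewrite /r !mulrDl mul1r.
  have : 0 <= (2 * I * I)%:R / N%:R :> R by apply: divr_ge0.
  have : 0 <= 1 / N%:R :> R by apply: divr_ge0.
  have : 0 <= C0 * d by apply: mulr_ge0.
  lra.
have CN0 : 0 <= C0 / N%:R by apply: divr_ge0.
have Id0 : 0 <= (2 * I * I)%:R * d by apply: mulr_ge0.
have r0 : 0 <= r by lra.
set B := phi I b i u.
have HB : B <= u0.
  rewrite /B phi_psiN; apply: le_trans uy.
  by rewrite lerBlDr lerDl mulr_ge0.
have key v : 0 <= v <= u1 + 1 ->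
  (B + r <= phi I psi0 i v + i%:R * t -> b i u <= psi0 i v + r) /\
  (phi I psi0 i v + i%:R * t + r <= B -> psi0 i v <= b i u + r).
  move=> Hv; have /andP[v0 _] := Hv.
  have [H1 H2] := HC0 N eta i u v t N0 HO Hi ux v0 t0.
  have Ha : `|psiN N eta i v 0 - psi0 i v| <= d by apply: Hd.
  have Hp : `|phi I (fun j x => psiN N eta j x 0) i v - phi I psi0 i v|
    <= (2 * I * I)%:R * d by apply: phi_close => // j Hj; apply: Hd.
  move: Ha Hp; rewrite !ler_norml => /andP[Ha1 Ha2] /andP[Hp1 Hp2].
  by split => H; [have := H1 ltac:(rewrite -/b -/B; lra)|
     have := H2 ltac:(rewrite -/b -/B; lra)]; rewrite -/(b i u); lra.
have keyz z : 0 <= z -> z <= u0 + 1 ->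
  (B + r <= z + i%:R * t -> b i u <= Upsilon I psi0 i z + r) /\
  (z + i%:R * t + r <= B -> Upsilon I psi0 i z <= b i u + r).
  move=> z0 z1; have [Hv0 Ev] := inv_phiP i HD z0.
  have := key (inv_pos (phi I psi0 i) z); rewrite Ev; apply.
  rewrite Hv0 /=; apply: (@le_trans _ _ u1); last by rewrite lerDl.
  rewrite leNgt; apply/negP => /(phi_lt i HD u10); rewrite Ev.
  by have := Hu1 i; lra.
have lip z1 z2 : 0 <= z1 -> 0 <= z2 -> z1 <= z2 ->
  Upsilon I psi0 i z2 <= Upsilon I psi0 i z1 + (z2 - z1).
  move=> z10 z20 z12.
  have := @Upsilon_lipschitz R I psi0 i (L i) z2 z1 HD (fun a c => Llip i a c Hi) z20 z10.
  have H : L i * `|z2 - z1| <= z2 - z1.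
    by rewrite ger0_norm ?subr_ge0 // -[leRHS]mul1r ler_wpM2r ?subr_ge0 // L1.
  by move=> /le_trans/(_ H); rewrite ler_norml => /andP[_]; lra.
have Hit : 0 <= i%:R * t by apply: mulr_ge0.
have b0 : 0 <= b i u by rewrite /b psiN_nsol mulr_ge0.
(* If the shifted argument is cut off at 0, the comparison point [z = r] gives the bound [2 * r]. *)
rewrite /theta; have [Hc|Hc] := leP (B - i%:R * t) 0.
  rewrite Upsilon0 // subr0 ger0_norm //.
  have [H _] := keyz r r0 ltac:(lra).
  have := H ltac:(lra); have := lip 0 r (lexx 0) r0 r0; rewrite Upsilon0 //; lra.
rewrite ler_norml; apply/andP; split; last first.
  have [H _] := keyz (B - i%:R * t + r) ltac:(lra) ltac:(lra).
  have := H ltac:(lra).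
  have := lip (B - i%:R * t) (B - i%:R * t + r) ltac:(lra) ltac:(lra) ltac:(lra); lra.
(* Close to 0 there is no comparison point on the left; there [Upsilon] is itself at most [r] and
   [b i u] is nonnegative. *)
have [Hr|Hr] := leP r (B - i%:R * t).
  have [_ H] := keyz (B - i%:R * t - r) ltac:(lra) ltac:(lra).
  have := H ltac:(lra).
  have := lip (B - i%:R * t - r) (B - i%:R * t) ltac:(lra) ltac:(lra) ltac:(lra); lra.
have := lip 0 (B - i%:R * t) ltac:(lra) ltac:(lra) ltac:(lra); rewrite Upsilon0 //; lra.
Qed.

Lemma deterministic_limit (R : realType) I (psi0 : nat -> R -> R) (eps t u0 : R) :
  inD I psi0 -> 0 < eps -> 0 <= t -> 0 <= u0 ->
  exists d u1 : R, exists N0 : nat, [/\ 0 < d, 0 < u1 &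
    forall N eta, (N0 <= N)%N -> OmegaI I eta ->
    (forall i u, (1 <= i <= I)%N -> 0 <= u <= u1 ->
       `|psiN N eta i u 0 - psi0 i u| <= d) ->
    forall i u, (1 <= i <= I)%N -> 0 <= u <= u0 ->
      `|psiN N eta i u t - Upsilon_inv I (theta t (Upsilon I psi0)) i u| <= eps].
Proof.
move=> HD eps0 t0 u00; have [L [L0 Lsum Llip]] := lipschitz_constants HD.
have [C [u1 [C0 u10 HC]]] := discrete_fixed_profile HD t0 u00.
pose c := 1 - 2 * \sum_(1 <= j < I.+1) j%:R * L j.
have c0 : 0 < c by rewrite /c; lra.
(* Stability yields the factor [2 * (I * I)]; the added 1 keeps [q] positive for [I = 0]. *)
pose q : R := (2 * (I * I) + 1)%:R.
have q0 : 0 < q by rewrite ltr0n; lia.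
pose r0 := Num.min 1 (eps * c / q).
have r00 : 0 < r0 by rewrite lt_min ltr01 /= divr_gt0 // mulr_gt0.
have r01 : r0 <= 1 by rewrite ge_min lexx.
have r0e : r0 * q <= eps * c by rewrite -ler_pdivlMr // ge_min lexx orbT.
have C1 : 0 < C + 1 by rewrite ltr_wpDl.
(* Both parts of the error, [C * d] and [C / N], are then at most [r0 / 2]. *)
exists (r0 / (2 * (C + 1))), u1, (Num.truncn (2 * C / r0)).+1; split => //.
  by rewrite divr_gt0 // mulr_gt0.
move=> N eta HN HO Hd i u Hi Hu.
have N0 : (0 < N)%N by exact: leq_trans HN.
have n0 : 0 < N%:R :> R by rewrite ltr0n.
set d := r0 / _ in Hd.
have d0 : 0 <= d by rewrite ltW // divr_gt0 // mulr_gt0.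
have HCd : C * d <= r0 / 2.
  have Ed : d * (2 * (C + 1)) = r0 by rewrite /d divfK // gt_eqF // mulr_gt0.
  by clearbody d; lra.
have HCN : C / N%:R <= r0 / 2.
  have : 2 * C / r0 <= N%:R.
    apply: (le_trans (ltW (truncnS_gt _))); by rewrite ler_nat.
  rewrite ler_pdivrMr // ler_pdivrMr //; lra.
have Hr : C / N%:R + C * d <= r0 by lra.
have /(_ i u Hi Hu) HF := HC N eta d N0 HO d0 Hd (le_trans Hr r01).
set r := C / N%:R + C * d in Hr HF.
have r_ge0 : 0 <= r by rewrite addr_ge0 // mulr_ge0 // invr_ge0 ltW.
set chi := theta t (Upsilon I psi0) in HF *.
set Psi := Upsilon_inv I chi.
have chilip j x y : (1 <= j <= I)%N -> `|chi j x - chi j y| <= L j * `|x - y|.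
  move=> Hj; rewrite /chi /theta.
  have Hm (z : R) : 0 <= Num.max z 0 by rewrite le_max lexx orbT.
  apply: le_trans (Upsilon_lipschitz HD _ _ _) _ => //.
    by move=> a b; exact: Llip.
  rewrite ler_wpM2l //; apply: le_trans (max0_lip _ _) _.
  by rewrite (_ : x - j%:R * t - (y - j%:R * t) = x - y) //; ring.
have Hst : `|psiN N eta i u t - Psi i u| * c <= (I * I)%:R * (2 * r).
  apply: (@phi_stability R I L (2 * r) (fun j x => psiN N eta j x t)) => //; last first.
    by rewrite mulr_ge0.
  move=> j Hj; have /andP[ux _] := Hu.
  rewrite {1}/Psi (Upsilon_inv_eq HD t0 Hj ux) -/chi -/Psi.
  have {}HF := HC N eta d N0 HO d0 Hd (le_trans Hr r01) j u Hj Hu.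
  have := chilip j (phi I (fun j x => psiN N eta j x t) j u) (phi I Psi j u) Hj.
  move=> H1; apply: le_trans (lerD H1 HF).
  by rewrite -/chi [leRHS]addrC; exact: ler_distD.
rewrite -(ler_pM2r c0); apply: le_trans Hst _; apply: le_trans r0e.
apply: (@le_trans _ _ (r0 * (2 * (I * I))%:R)).
  by rewrite mulrA mulrC [(2 * (I * I))%N]mulnC [(I * I * 2)%:R]natrM ler_wpM2r // mulr_ge0.
by rewrite ler_wpM2l ?(ltW r00) // ler_nat leq_addr.
Qed.

(** * Measurability *)

(** For countably many values the level sets suffice: every event in terms of [X] is a countable
    union of them. *)
Definition discrete_measurable (d : measure_display) (T : measurableType d)
  (C : countType) (X : T -> C) := forall c, measurable [set w | X w = c].

Lemma measurable_const (d : measure_display) (T : measurableType d) (Q : Prop) :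
  measurable [set _ : T | Q].
Proof.
case: (pselect Q) => HQ.
  by rewrite (_ : [set _ | _] = setT) //; apply/seteqP; split.
by rewrite (_ : [set _ | _] = set0) //; apply/seteqP; split.
Qed.

Lemma measurable_ex (d : measure_display) (T : measurableType d) (C : countType)
  (P : C -> T -> Prop) :
  (forall c, measurable [set w | P c w]) -> measurable [set w | exists c, P c w].
Proof.
move=> H; rewrite (_ : [set w | _] = \bigcup_c [set w | P c w]).
  exact: countable_bigcupT_measurable.
by apply/seteqP; split => w [c] //; [exists c | move=> _ ?; exists c].
Qed.

Lemma measurable_all (d : measure_display) (T : measurableType d) (C : countType)
  (P : C -> T -> Prop) :
  (forall c, measurable [set w | P c w]) -> measurable [set w | forall c, P c w].
Proof.
move=> H; rewrite (_ : [set w | _] = ~` [set w | exists c, ~ P c w]).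
  apply: measurableC; apply: measurable_ex => c.
  rewrite (_ : [set w | _] = ~` [set w | P c w]) //; exact: measurableC.
apply/seteqP; split => w /= Hw; first by case=> c; apply.
by move=> c; apply: contrapT => Hc; apply: Hw; exists c.
Qed.

Lemma measurable_pred (d : measure_display) (T : measurableType d) (C : countType)
  (X : T -> C) (Q : C -> Prop) :
  discrete_measurable X -> measurable [set w | Q (X w)].
Proof.
move=> HX; rewrite (_ : [set w | _] = [set w | exists c, X w = c /\ Q c]).
  apply: measurable_ex => c; apply: measurableI; first exact: HX.
  exact: measurable_const.
by apply/seteqP; split => w /=; [move=> ?; exists (X w) | case=> c [-> ]].
Qed.

Lemma discrete_measurable_comp (d : measure_display) (T : measurableType d)
  (C D : countType) (X : T -> C) (f : C -> D) :
  discrete_measurable X -> discrete_measurable (fun w => f (X w)).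
Proof. by move=> HX e; apply: (@measurable_pred _ _ _ X (fun c => f c = e)). Qed.

Lemma discrete_measurable_comp2 (d : measure_display) (T : measurableType d)
  (C D E : countType) (X : T -> C) (Y : T -> D) (f : C -> D -> E) :
  discrete_measurable X -> discrete_measurable Y ->
  discrete_measurable (fun w => f (X w) (Y w)).
Proof.
move=> HX HY.
apply: (@discrete_measurable_comp _ _ _ _ (fun w => (X w, Y w)) (fun p => f p.1 p.2)).
move=> [c e]; rewrite (_ : [set w | _] = [set w | X w = c] `&` [set w | Y w = e]).
  exact: measurableI.
by apply/seteqP; split => w /=; [case=> -> -> | case=> -> ->].
Qed.

Lemma discrete_measurable_cst (d : measure_display) (T : measurableType d)
  (C : countType) (c : C) : discrete_measurable (fun _ : T => c).
Proof. by move=> e; exact: measurable_const. Qed.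

Definition config_measurable (d : measure_display) (T : measurableType d)
  (eta : T -> config) := forall x, discrete_measurable (fun w => eta w x).

Lemma carrier_measurable (d : measure_display) (T : measurableType d)
  (eta : T -> config) x : config_measurable eta ->
  discrete_measurable (fun w => carrier (eta w) x).
Proof.
move=> H; elim: x => [|x IH] /=; first exact: discrete_measurable_cst.
exact: (@discrete_measurable_comp2 _ _ _ _ _ _ _
  (fun (b : bool) (c : nat) => if b then c.+1 else if c == 0%N then 0%N else c.-1)).
Qed.

Lemma iter_measurable (d : measure_display) (T : measurableType d)
  (eta : T -> config) t : config_measurable eta ->
  config_measurable (fun w => iter t bbs_step (eta w)).
Proof.
move=> H; elim: t => //= t IH [|x].
  exact: (@discrete_measurable_cst _ _ _ false).
apply: (@discrete_measurable_comp2 _ _ _ _ _ _ _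
  (fun (b : bool) (c : nat) => minn (1 - b) c == 1%N)) => //.
exact: carrier_measurable.
Qed.

Lemma Spath_measurable (d : measure_display) (T : measurableType d)
  (eta : T -> config) x : config_measurable eta ->
  discrete_measurable (fun w => Spath (eta w) x).
Proof.
move=> H; elim: x => [|x IH].
  rewrite (_ : (fun w => _) = fun=> 0); first exact: discrete_measurable_cst.
  by apply/funext => w; rewrite /Spath big_geq.
rewrite (_ : (fun w => _) = fun w => Spath (eta w) x +
  (1 - 2 * (nat_of_bool (eta w x.+1))%:Z)); last by apply/funext => w; rewrite SpathS.
exact: (@discrete_measurable_comp2 _ _ _ _ _ _ _
  (fun (s : int) (b : bool) => s + (1 - 2 * (nat_of_bool b)%:Z))).
Qed.

Lemma Mpath_measurable (d : measure_display) (T : measurableType d)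
  (eta : T -> config) x : config_measurable eta ->
  discrete_measurable (fun w => Mpath (eta w) x).
Proof.
move=> H; elim: x => [|x IH] /=; first exact: Spath_measurable.
apply: (@discrete_measurable_comp2 _ _ _ _ _ _ _ (fun a b : int => Num.max a b)) => //.
exact: Spath_measurable.
Qed.

Lemma is_record_measurable (d : measure_display) (T : measurableType d)
  (eta : T -> config) x : config_measurable eta ->
  discrete_measurable (fun w => is_record (eta w) x).
Proof.
move=> H; apply: (@discrete_measurable_comp2 _ _ _ _ _ _ _
  (fun a b : int => (x == 0%N) || (a < b))); exact: Mpath_measurable.
Qed.

Lemma segment_measurable (d : measure_display) (T : measurableType d)
  (eta : T -> config) x0 x1 : config_measurable eta ->
  discrete_measurable (fun w => segment (eta w) x0 x1).
Proof.
move=> H; rewrite /segment; elim: (iota _ _) => [|x s IH].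
  exact: (@discrete_measurable_cst _ _ _ [::]).
exact: (@discrete_measurable_comp2 _ _ _ _ _ _ _
  (fun (b : bool) (l : seq (nat * bool)) => (x, b) :: l)).
Qed.

Lemma has_soliton_measurable (d : measure_display) (T : measurableType d)
  (eta : T -> config) i x : config_measurable eta ->
  measurable [set w | has_soliton (eta w) i x].
Proof.
move=> H; apply: measurable_ex => x0; apply: measurable_ex => x1.
apply: measurableI; last first.
  apply: (@measurable_pred _ _ _ _ (fun s : seq (nat * bool) => (i, x) \in soliton_decomp s)).
  exact: segment_measurable.
rewrite (_ : (fun w : T => consecutive_records _ _ _) = [set w | is_record (eta w) x0] `&`
  ([set w | is_record (eta w) x1] `&` ([set _ | (x0 < x1)%N] `&`
   [set w | forall y, (x0 < y < x1)%N -> ~~ is_record (eta w) y]))).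
  have Hr y : measurable [set w | is_record (eta w) y].
    by apply: (@measurable_pred _ _ _ _ (fun b : bool => b)); exact: is_record_measurable.
  apply: measurableI => //; apply: measurableI => //; apply: measurableI.
    exact: measurable_const.
  apply: measurable_all => y.
  apply: (@measurable_pred _ _ _ _ (fun b : bool => (x0 < y < x1)%N -> ~~ b)).
  exact: is_record_measurable.
by apply/seteqP; split => w /=; [case | case=> ? [? []]].
Qed.

Lemma sigma_measurable (d : measure_display) (T : measurableType d)
  (eta : T -> config) i x t : config_measurable eta ->
  discrete_measurable (fun w => sigma (eta w) i x t).
Proof.
move=> H; apply: (@discrete_measurable_comp _ _ _ _
  (fun w => `[< has_soliton (iter t bbs_step (eta w)) i x >])
  (fun b : bool => if b then 1%N else 0%N)).
have HE : measurable [set w | has_soliton (iter t bbs_step (eta w)) i x].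
  by apply: has_soliton_measurable; exact: iter_measurable.
case.
  rewrite (_ : [set w | _] = [set w | has_soliton (iter t bbs_step (eta w)) i x]) //.
  by apply/seteqP; split => w /= /asboolP.
rewrite (_ : [set w | _] = ~` [set w | has_soliton (iter t bbs_step (eta w)) i x]).
  exact: measurableC.
apply/seteqP; split => w /=; first by move/negbT/asboolPn.
by move/asboolPn/negbTE.
Qed.

Lemma nsol_measurable (d : measure_display) (T : measurableType d)
  (eta : T -> config) t i x : config_measurable eta ->
  discrete_measurable (fun w => nsol (eta w) t i x).
Proof.
move=> H; rewrite /nsol; elim: x => [|x IH].
  rewrite (_ : (fun w => _) = fun=> 0%N); first exact: discrete_measurable_cst.
  by apply/funext => w; rewrite big_geq.
rewrite (_ : (fun w => _) = fun w => (\sum_(1 <= y < x.+1) sigma (eta w) i y t +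
  sigma (eta w) i x.+1 t)%N); last by apply/funext => w; rewrite big_nat_recr.
apply: (@discrete_measurable_comp2 _ _ _ _ _ _ _ addn) => //.
exact: sigma_measurable.
Qed.

Lemma OmegaI_measurable (d : measure_display) (T : measurableType d)
  (eta : T -> config) I : config_measurable eta ->
  measurable [set w | OmegaI I (eta w)].
Proof.
move=> H; apply: measurableI.
  apply: measurable_all => K; apply: measurable_all => x0.
  rewrite (_ : [set w | _] = [set w | exists x, (x0 <= x)%N /\ K <= Spath (eta w) x]).
    apply: measurable_ex => x.
    apply: (@measurable_pred _ _ _ _ (fun s : int => (x0 <= x)%N /\ K <= s)).
    exact: Spath_measurable.
  by apply/seteqP; split => w /= [x]; [exists x | case; exists x].
apply: measurable_all => i; apply: measurable_all => x.
apply: (@measurable_pred _ _ _ _ (fun s : nat => (I < i)%N -> s = 0%N)).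
exact: sigma_measurable.
Qed.

Lemma lt_sup_dev (R : realType) I (f g : nat -> R -> R) (u0 eps : R) :
  (eps%:E < sup_dev I f g u0)%E <->
  exists i u, [/\ (1 <= i <= I)%N, 0 <= u <= u0 & eps < `|f i u - g i u|].
Proof.
split.
  case/ereal_sup_gt => _ [i [u [Hi Hu ->]]]; rewrite lte_fin => H.
  by exists i, u.
case=> i [u [Hi Hu H]].
apply: (@lt_le_trans _ _ (`|f i u - g i u|)%:E); first by rewrite lte_fin.
by apply: ereal_sup_ubound; exists i, u.
Qed.

(** The supremum over [u] is uncountable, but the randomness enters only through [nsol] at the
    integer part [n] of [N * u]. For fixed [i] and [n] the existence of [u] is a deterministic
    condition on a natural number. *)
Lemma sup_dev_measurable (R : realType) (d : measure_display) (T : measurableType d)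
  (eta : T -> config) I N (g : nat -> R -> R) (eps t u0 : R) : config_measurable eta ->
  measurable [set w | (eps%:E < sup_dev I (fun i u => psiN N (eta w) i u t) g u0)%E].
Proof.
move=> H; set k := Num.truncn (N%:R * t).
rewrite (_ : [set w | _] = [set w | exists i n : nat, (1 <= i <= I)%N /\
    exists u : R, [/\ 0 <= u <= u0, Num.truncn (N%:R * u) = n &
     eps < `|N%:R^-1 * (nsol (eta w) k i n)%:R - g i u|]]).
  apply: measurable_ex => i; apply: measurable_ex => n.
  apply: (@measurable_pred _ _ _ _ (fun c : nat => (1 <= i <= I)%N /\
    exists u : R, [/\ 0 <= u <= u0, Num.truncn (N%:R * u) = n &
     eps < `|N%:R^-1 * c%:R - g i u|])).
  exact: nsol_measurable.
apply/seteqP; split => w /=.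
  move/lt_sup_dev => [i [u [Hi Hu Hlt]]]; exists i, (Num.truncn (N%:R * u)).
  by split => //; exists u; split => //; rewrite -psiN_nsol.
case=> i [n [Hi [u [Hu Hn Hlt]]]]; apply/lt_sup_dev; exists i, u; split => //.
by rewrite psiN_nsol Hn.
Qed.

(** * From the deterministic estimate to convergence in probability *)

Unset Implicit Arguments.

Theorem theorem1p3 (R : realType) (I : nat) (d : measure_display)
  (T : nat -> measurableType d) (P : forall N : nat, probability (T N) R)
  (eta : forall N : nat, T N -> config)
  (eta_meas : forall (N x : nat), measurable [set w | eta N w x])
  (eta_supp : forall N : nat, P N [set w | OmegaI I (eta N w)] = 1%E)
  (psi0 : nat -> R -> R) (psi0_D : inD I psi0)
  (init : forall eps u0 : R, 0 < eps -> 0 < u0 ->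
     (fun N => P N [set w | (eps%:E <
        sup_dev I (fun i u => psiN N (eta N w) i u 0) psi0 u0)%E])
       @ \oo --> 0%E) :
  forall eps t u0 : R, 0 < eps -> 0 < t -> 0 < u0 ->
     (fun N => P N [set w | (eps%:E <
        sup_dev I (fun i u => psiN N (eta N w) i u t)
                  (Upsilon_inv I (theta t (Upsilon I psi0))) u0)%E])
       @ \oo --> 0%E.
Proof.
move=> eps t u0 eps0 t0 u00.
have Hm N : config_measurable (eta N).
  move=> x [].
    rewrite (_ : [set w | _] = [set w | eta N w x]) //.
  rewrite (_ : [set w | _] = ~` [set w | eta N w x]).
    exact: (measurableC (eta_meas N x)).
  by apply/seteqP; split => w /=; [move=> -> | move/negP/negbTE].
have [del [u1 [N0 [d0 u10 HN0]]]] := deterministic_limit psi0_D eps0 (ltW t0) (ltW u00).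
(* The probability at time [t] is squeezed between 0 and the initial one with tolerance [del] and
   horizon [u1]. *)
apply: squeeze_cvge (init del u1 d0 u10); [|exact: cvg_cst].
exists N0 => // N /= HN; rewrite measure_ge0 /=.
set A := [set w | _]; set B := [set w | _].
have HO : measurable [set w | OmegaI I (eta N w)] by exact: OmegaI_measurable.
have mA : measurable A by exact: sup_dev_measurable.
have mB : measurable B by exact: sup_dev_measurable.
(* On [OmegaI], a deviation above [eps] at time [t] forces one above [del] at time 0; the complement
   of [OmegaI] is a null event. *)
have HAB : A `<=` B `|` ~` [set w | OmegaI I (eta N w)].
  move=> w; rewrite /A /= => /lt_sup_dev[i [u [Hi Hu Hlt]]].
  have [HOw|] := pselect (OmegaI I (eta N w)); last by right.
  left; apply: contrapT => HB; move: Hlt; apply/negP; rewrite -leNgt.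
  apply: (HN0 N (eta N w) HN HOw) => // j v Hj Hv.
  rewrite leNgt; apply/negP => Hlt; apply: HB; rewrite /B /=.
  by apply/lt_sup_dev; exists j, v.
apply: (@le_trans _ _ (P N (B `|` ~` [set w | OmegaI I (eta N w)]))).
  by apply: le_measure; rewrite ?inE //; apply: measurableU => //; exact: measurableC.
apply: le_trans (measureU2 _ mB (measurableC HO)) _.
have H0 : (P N (~` [set w | OmegaI I (eta N w)]) <= 0)%E.
  by rewrite probability_setC // eta_supp subee.
by rewrite -[leRHS]adde0; exact: (leeD (lexx _) H0).
Qed.
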